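(* For every integer $\ell\ge1$, writing $\Pi_2=\pi(n)+\pi(\frac n2)$ and $\Pi_3=\pi(n)+\pi(\frac n2)+\pi(\frac n3)$: (1) $\frac{n^{\frac{9\ell}{18\ell-2}}}{(\log n)^{\frac{9\ell}{9\ell-1}}}\ll F_{36\ell,3}(n)-\Pi_2\ll n^{5/6}$; (2) $\frac{n^{\frac{9\ell}{18\ell-2}}}{(\log n)^{\frac{9\ell}{9\ell-1}}}\ll F_{36\ell+3,3}(n)-\Pi_3\ll n^{5/6}$; (3) $\frac{n^{\frac{9\ell+1}{18\ell}}}{(\log n)^{\frac{9\ell+1}{9\ell}}}\ll F_{36\ell+6,3}(n)-\Pi_3\ll n^{5/6}$; (4) $\frac{n^{\frac{9\ell+1}{18\ell}}}{(\log n)^{\frac{9\ell+1}{9\ell}}}\ll F_{36\ell+9,3}(n)-\Pi_2\ll n^{5/6}$; (5) $\frac{n^{\frac{9\ell+3}{18\ell+4}}}{(\log n)^{\frac{9\ell+3}{9\ell+2}}}\ll F_{36\ell+12,3}(n)-\Pi_3\ll n^{5/6}$; (6) $\frac{n^{\frac{9\ell+3}{18\ell+4}}}{(\log n)^{\frac{9\ell+3}{9\ell+2}}}\ll F_{36\ell+15,3}(n)-\Pi_3\ll n^{5/6}$; (7) $\frac{n^{\frac{9\ell+4}{18\ell+6}}}{(\log n)^{\frac{9\ell+4}{9\ell+3}}}\ll F_{36\ell+18,3}(n)-\Pi_2\ll n^{5/6}$; (8) $\frac{n^{\frac{9\ell+4}{18\ell+6}}}{(\log n)^{\frac{9\ell+4}{9\ell+3}}}\ll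 F_{36\ell+21,3}(n)-\Pi_3\ll n^{5/6}$; (9) $\frac{n^{\frac{9\ell+6}{18\ell+10}}}{(\log n)^{\frac{9\ell+6}{9\ell+5}}}\ll F_{36\ell+24,3}(n)-\Pi_3\ll n^{5/6}$; (10) $\frac{n^{\frac{9\ell+6}{18\ell+10}}}{(\log n)^{\frac{9\ell+6}{9\ell+5}}}\ll F_{36\ell+27,3}(n)-\Pi_2\ll n^{5/6}$; (11) $\frac{n^{\frac{9\ell+7}{18\ell+12}}}{(\log n)^{\frac{9\ell+7}{9\ell+6}}}\ll F_{36\ell+30,3}(n)-\Pi_3\ll n^{5/6}$; (12) $\frac{n^{\frac{9\ell+7}{18\ell+12}}}{(\log n)^{\frac{9\ell+7}{9\ell+6}}}\ll F_{36\ell+33,3}(n)-\Pi_3\ll n^{5/6}$.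
   Context: $\log$ is the natural logarithm, $\pi(x)$ is the number of primes not exceeding $x$. $X\ll Y$ means there is a constant $c>0$ (which may depend on $\ell$) with $X\le cY$ for all sufficiently large $n$. $F_{k,d}(n)$ is the maximal size of a set $A\subseteq\{1,\dots,n\}$ such that the equation $a_1a_2\cdots a_k=x^d$ with $a_1<a_2<\dots<a_k$ has no solution with $a_1,\dots,a_k\in A$ and $x$ an integer. *)

(* Defs.v *)
From HB Require Import structures.
From mathcomp Require Import all_boot all_order all_algebra.
From mathcomp Require Import all_classical all_reals all_analysis.

Set Implicit Arguments.
Unset Strict Implicit.
Unset Printing Implicit Defensive.

Import Order.TTheory GRing.Theory Num.Theory.
Import numFieldNormedType.Exports.

Local Open Scope classical_set_scope.
Local Open Scope ring_scope.

Definition primepi (R : realType) (x : R) : nat :=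
  #|[pred p : 'I_(Num.truncn x).+1 | prime p]|.

(* Subsets of {1, ..., n} are the sets over 'I_n.+1 that do not contain 0. *)
Definition has_power_solution (k d n : nat) (A : {set 'I_n.+1}) : Prop :=
  exists (a : 'I_k -> 'I_n.+1) (x : int),
    [/\ forall i j : 'I_k, (i < j)%N -> (a i < a j)%N,
        forall i : 'I_k, a i \in A
      & \prod_(i < k) (a i)%:Z = x ^+ d].

Definition maxfree (k d n : nat) : nat :=
  (\max_(A : {set 'I_n.+1} |
     (ord0 \notin A) && `[< ~ has_power_solution k d A >]) #|A|)%N.

Definition Pi2 (R : realType) (n : nat) : R :=
  (primepi (n%:R : R))%:R + (primepi (n%:R / 2 : R))%:R.

Definition Pi3 (R : realType) (n : nat) : R :=
  Pi2 R n + (primepi (n%:R / 3 : R))%:R.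

(* One-sided, without absolute values: X may be negative. *)
Definition vinogradov_le (R : realType) (X Y : nat -> R) : Prop :=
  exists2 c : R, 0 < c & \forall n \near \oo, X n <= c * Y n.

Notation "X \ll Y" := (vinogradov_le X Y)
  (at level 70, no associativity) : ring_scope.

(* Main.v *)
Require Import Defs.
From HB Require Import structures.
From mathcomp Require Import all_boot all_order all_algebra.
From mathcomp Require Import all_classical all_reals all_analysis.
From mathcomp Require Import zify ring lra.
From mathcomp Require Import fintype finset.

Import Order.TTheory GRing.Theory Num.Theory.
Import numFieldNormedType.Exports.

Set Implicit Arguments.
Unset Strict Implicit.
Unset Printing Implicit Defensive.

(** Upper bound. Every [a >= 1] factors as [u * v] with [u <= v] and [v] prime
    or [v ^ 3 <= a ^ 2], so a set [A] is a bipartite graph with edges [(u, v)].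
    Three [u]'s with [3i] common neighbours [v] give [9i] elements with cube
    product, and [K_{4,4}] minus a perfect matching gives [12]; unions of these
    realise every [k >= 36] divisible by [3]. If the first is absent, then
    counting triples of bounded codegree over dyadic blocks of [v] gives
    [sum_v (deg v - 2)^+ << n^(5/6)], if the second is absent then
    [sum_v (deg v - 3)^+ << n^(5/6)]. The remaining part [min (deg v) r] of the
    degrees contributes [pi(n) + ... + pi(n / r)] over prime [v], since
    [deg v <= n / v], and [O(n^(2/3))] over the other [v].

    Lower bound. Take all multiples [p, 2p] (and [3p] when [9] does not divide
    [k]) of primes [p > M], [M] about [n^(1/2)], together with a set [X] of
    products of two distinct primes in [(3, M]]. A cube product using a
    multiple of such a [p] uses all of [p, 2p, 3p], and the exponent of [2]
    forces the number of these [p] to be divisible by [3]; so the elements from [X] already have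
    cube product and their number is congruent to [k] modulo [9]. A product of
    [j] elements of [X] that is a cube involves at most [2j/3] primes, so a
    random [X] of density [N^(-2/3)], with [N] primes available, contains only
    [O(1)] bad subsets on average, and deletion leaves about [N^(4/3)]
    elements. *)

(** * Cube products from a bipartite graph *)

Definition has_cube_subset (k n : nat) (A : {set 'I_n.+1}) : Prop :=
  exists S : {set 'I_n.+1},
    [/\ S \subset A, #|S| = k & exists x : nat, \prod_(a in S) (a : nat) = x ^ 3].

(** Take for [v] the least divisor of [a] with [a <= v ^ 2]. If [v] is composite with least prime
    factor [p] and [w = v / p], minimality gives [w ^ 2 < a], so [u * p] is again a candidate and
    [w <= u]. Hence [v = w * p <= w ^ 2 <= u ^ 2] and [v ^ 3 <= (u * v) ^ 2]. *)
Lemma balanced_factor (a : nat) : 0 < a ->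
  exists uv : nat * nat,
    [/\ uv.1 * uv.2 = a, uv.1 <= uv.2 & prime uv.2 || (uv.2 ^ 3 <= a ^ 2)].
Proof.
move=> a0.
have ex : exists v, (v %| a) && (a <= v ^ 2).
  by exists a; rewrite dvdnn /= leq_pmull.
case: (ex_minnP ex) => v /andP[/dvdnP[u au] av] vmin.
have v0 : 0 < v by move: a0; rewrite au muln_gt0 => /andP[].
have uv : u <= v by move: av; rewrite au expnS expn1 leq_pmul2r.
exists (u, v); split=> //=; case: (boolP (prime v)) => //= nv.
case: (leqP v 1) => [v1|v1].
  have -> : v = 1 by lia.
  by rewrite exp1n expn_gt0 a0.
have pv := pdiv_prime v1; have /dvdnP[w vw] := pdiv_dvd v.
set p := pdiv v in pv vw.
have p1 := prime_gt1 pv.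
have w0 : 0 < w by move: v0; rewrite vw muln_gt0 => /andP[].
have pw : p <= w.
  have := pdiv_min_dvd (m := v) (d := w).
  rewrite -/p; apply; last by rewrite vw dvdn_mulr.
  rewrite ltn_neqAle w0 andbT eq_sym; apply/eqP => w1.
  by move: nv; rewrite vw w1 mul1n pv.
have wv : w < v by rewrite vw -{1}[w]muln1 ltn_pmul2l.
have aw : w ^ 2 < a.
  rewrite ltnNge; apply/negP => aw.
  have /vmin : (w %| a) && (a <= w ^ 2) by rewrite aw andbT au vw mulnA dvdn_mulr // dvdn_mull.
  by rewrite leqNgt wv.
have : v <= u * p.
  apply: vmin; rewrite au vw (_ : u * (w * p) = u * p * w); last by lia.
  have wup : w < u * p by move: aw; rewrite au vw; nia.
  by rewrite dvdn_mulr //= expnS expn1 leq_mul2l ltnW ?orbT.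
rewrite {1}vw leq_pmul2r ?prime_gt0 // => uw.
have vu : v <= u ^ 2.
  by rewrite vw; apply: leq_trans (leq_mul (leqnn w) pw) _; exact: (leq_mul uw uw).
by rewrite au expnMn expnS leq_pmul2r ?expn_gt0 ?v0.
Qed.

Lemma has_cube_subset_setU k1 k2 n (A S1 S2 : {set 'I_n.+1}) : [disjoint S1 & S2] ->
  S1 \subset A -> #|S1| = k1 -> (exists x, \prod_(a in S1) (a : nat) = x ^ 3) ->
  S2 \subset A -> #|S2| = k2 -> (exists x, \prod_(a in S2) (a : nat) = x ^ 3) ->
  has_cube_subset (k1 + k2) A.
Proof.
move=> dis sA1 c1 [x1 p1] sA2 c2 [x2 p2]; exists (S1 :|: S2); split.
- by rewrite subUset sA1.
- by rewrite cardsU c1 c2 disjoint_setI0 // cards0 subn0.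
exists (x1 * x2); rewrite expnMn -p1 -p2 (eq_bigl [predU S1 & S2]) ?bigU //.
by move=> i; rewrite !inE.
Qed.

(** Removing a first cube subset costs only [k1] elements, and the second one is sought in the
    remainder, which makes the two disjoint. *)
Lemma cube_subset_split k1 k2 n (A : {set 'I_n.+1}) c :
  (forall B : {set 'I_n.+1}, B \subset A -> #|A| <= #|B| + k1 -> has_cube_subset k2 B) ->
  has_cube_subset k1 A -> c = k1 + k2 -> has_cube_subset c A.
Proof.
move=> hB [S [SA cS pS]] ->.
have [] := hB (A :\: S); first exact: subsetDl.
  by rewrite cardsD (setIidPr SA) -cS subnK // subset_leq_card.
move=> S2 [S2A c2 p2]; apply: (@has_cube_subset_setU _ _ _ _ S S2) => //.
  rewrite disjoint_sym; apply: disjointWl S2A _.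
  by apply/pred0P => a /=; rewrite inE andbC andbA andbN.
by apply: subset_trans S2A _; exact: subsetDl.
Qed.

(** Double counting of the pairs [(v, S)] with [S] in [F] and [S \subset nb v]: each such [S] is one
    of the [m]-subsets of [U] and occurs at most [s] times. *)
Lemma sum_bounded_codegree (T : finType) (nb : T -> {set T}) (I U : {set T})
    (F : {set {set T}}) (m s : nat) :
  (forall v, v \in I -> nb v \subset U) ->
  (forall S : {set T}, S \in F -> #|S| = m) ->
  (forall S : {set T}, S \in F -> #|[set v | S \subset nb v]| <= s) ->
  \sum_(v in I) #|[set S in F | S \subset nb v]| <= s * 'C(#|U|, m).
Proof.
move=> nbU Fm Fs.
under eq_bigr => v _ do rewrite -sum1dep_card.
rewrite (exchange_big_dep (fun S : {set T} => (S \in F) && (S \subset U))) /=; last first.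
  by move=> v S vI /andP[-> SN] /=; apply: subset_trans SN (nbU _ vI).
rewrite -cards_draws -sum1dep_card big_distrr /= [leqRHS](bigID (fun S => S \in F)) /=.
apply: leq_trans (leq_addr _ _).
rewrite [leqRHS](eq_bigl (fun S : {set T} => (S \in F) && (S \subset U))); last first.
  move=> S; case: (boolP (S \in F)) => SF; rewrite ?andbF // ?andbT /=.
  by rewrite Fm // eqxx andbT.
apply: leq_sum => S /andP[SF _]; rewrite muln1 sum1dep_card.
apply: leq_trans (Fs _ SF); apply: subset_leq_card; apply/subsetP => v.
by rewrite !inE => /and3P[].
Qed.

(** Greedy choice: fewer than [size s] values are in use whenever a new one is needed. The given
    element of [U] is the value outside [s]. *)
Lemma distinct_representatives (T U : finType) (C : T -> {set U}) (s : seq T) :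
  uniq s -> (forall q, q \in s -> size s <= #|C q|) ->
  U -> exists w : T -> U, {in s &, injective w} /\ forall q, q \in s -> w q \in C q.
Proof.
move=> us Cs u0.
suff: forall t, subseq t s -> exists w : T -> U,
    {in t &, injective w} /\ forall q, q \in t -> w q \in C q by apply.
elim=> [|a t IH] ts; first by exists (fun=> u0).
have [|w [wi wC]] := IH; first by apply: subseq_trans ts; exact: subseq_cons.
have uat := subseq_uniq ts us.
have /andP[ant ut] := uat.
have [z /setDP[zC zw]] : exists z, z \in C a :\: [set w q | q in t].
  apply/set0Pn; rewrite -card_gt0 cardsD subn_gt0.
  apply: leq_trans (Cs a (mem_subseq ts (mem_head _ _))).
  apply: leq_trans (size_subseq ts) => /=; rewrite ltnS.
  apply: leq_trans (subset_leq_card (subsetIr _ _)) _.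
  by apply: leq_trans (leq_imset_card _ _) _; rewrite card_size.
exists (fun q => if q == a then z else w q); split.
  move=> p q; rewrite !inE; case: eqVneq => [->|pa] /=; case: eqVneq => [->|qa] //= pt qt.
  - by move=> zwq; move: zw; rewrite zwq imset_f.
  - by move=> zwq; move: zw; rewrite -zwq imset_f.
  exact: wi.
move=> q; rewrite inE; case: eqVneq => [->|qa] //= qt; exact: wC.
Qed.

(** The bipartite graph of factorisations as produced by [balanced_factor]. The last two clauses
    make the edges correspond one to one to the elements of [A], so that [#|A|] becomes a sum of
    degrees. *)
Definition factor_graph n (A : {set 'I_n.+1}) (nb : 'I_n.+1 -> {set 'I_n.+1}) : Prop :=
  [/\ forall u v, u \in nb v ->
        [/\ 0 < u, u <= v, u * v <= n, inord (u * v) \in A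
          & prime v || (v ^ 3 <= (u * v) ^ 2)],
      forall u v u' v', u \in nb v -> u' \in nb v' -> u * v = u' * v' ->
        (u, v) = (u', v')
    & #|A| = \sum_v #|nb v|].

Lemma factor_graph_exists n (A : {set 'I_n.+1}) : ord0 \notin A ->
  exists nb, factor_graph A nb.
Proof.
move=> A0.
have [f fP] : exists f : nat -> nat * nat, forall a, 0 < a ->
    [/\ (f a).1 * (f a).2 = a, (f a).1 <= (f a).2
      & prime (f a).2 || ((f a).2 ^ 3 <= a ^ 2)].
  have /choice[f fP] : forall a, exists uv : nat * nat, 0 < a ->
      [/\ uv.1 * uv.2 = a, uv.1 <= uv.2 & prime uv.2 || (uv.2 ^ 3 <= a ^ 2)].
    move=> [|a]; first by exists (0, 0).
    by have [uv uvP] := balanced_factor (ltn0Sn a); exists uv.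
  by exists f.
have Agt (a : 'I_n.+1) : a \in A -> 0 < a.
  move=> aA; rewrite lt0n; apply/eqP => a0; move: A0; rewrite (_ : ord0 = a) ?aA //.
  exact: val_inj.
have f1lt (a : 'I_n.+1) : a \in A -> (f a).1 < n.+1.
  move=> /Agt a0; have [fa fle _] := fP _ a0; apply: leq_ltn_trans (ltn_ord a).
  by rewrite -[leqRHS]fa leq_pmulr //; move: a0; rewrite -{1}fa muln_gt0 => /andP[].
have f2lt (a : 'I_n.+1) : a \in A -> (f a).2 < n.+1.
  move=> /Agt a0; have [fa fle _] := fP _ a0; apply: leq_ltn_trans (ltn_ord a).
  by rewrite -[leqRHS]fa leq_pmull //; move: a0; rewrite -{1}fa muln_gt0 => /andP[].
pose nb (v : 'I_n.+1) : {set 'I_n.+1} :=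
  [set inord (f a).1 | a : 'I_n.+1 in [set a in A | (f a).2 == v]].
have nbP u v : u \in nb v -> exists2 a : 'I_n.+1, a \in A & f a = (u : nat, v : nat).
  case/imsetP => a; rewrite inE => /andP[aA /eqP fv] ->; exists a => //.
  by rewrite inordK ?f1lt // -fv; case: (f a).
exists nb; split.
- move=> u v /nbP[a aA fa]; have [] := fP _ (Agt _ aA); rewrite fa /= => auv uv pv.
  rewrite auv inord_val aA pv uv leq_ord; split=> //.
  by have := Agt _ aA; rewrite -auv muln_gt0 => /andP[].
- move=> u v u' v' /nbP[a aA fa] /nbP[a' a'A fa'] e.
  have [] := fP _ (Agt _ aA); rewrite fa /= => ea _ _.
  have [] := fP _ (Agt _ a'A); rewrite fa' /= => ea' _ _.
  have aa : a = a' :> nat by rewrite -ea -ea'.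
  by move: fa'; rewrite -aa fa => -[/val_inj -> /val_inj ->].
- rewrite -sum1_card (partition_big (fun a : 'I_n.+1 => inord (f a).2 : 'I_n.+1) predT) //=.
  apply: eq_bigr => v _; rewrite card_in_imset; last first.
    move=> a b; rewrite !inE => /andP[aA /eqP fa] /andP[bA /eqP fb] /(congr1 val).
    rewrite /= !inordK ?f1lt // => e; apply: val_inj.
    have [ea _ _] := fP _ (Agt _ aA); have [eb _ _] := fP _ (Agt _ bA).
    by apply: etrans (esym ea) _; rewrite e fa -fb.
  rewrite -sum1_card; apply: eq_bigl => a; rewrite !inE.
  by case: (boolP (a \in A)) => aA //=; rewrite -val_eqE /= inordK ?f2lt.
Qed.

(** Distinct edges give distinct elements of [A], so edges with cube product yield a cube subset.
    The index type is arbitrary because the configurations below are indexed by pairs of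
    vertices. *)
Lemma factor_graph_cube n (A : {set 'I_n.+1}) nb (T : finType) (D : {set T})
    (g h : T -> 'I_n.+1) k x :
  factor_graph A nb -> (forall t, t \in D -> g t \in nb (h t)) ->
  {in D &, forall s t, g s = g t -> h s = h t -> s = t} -> #|D| = k ->
  \prod_(t in D) (g t * h t) = x ^ 3 -> has_cube_subset k A.
Proof.
move=> [nbP nbI _] gh inj cD pD.
have ghle t : t \in D -> g t * h t < n.+1.
  by move=> tD; have [_ _ ? _ _] := nbP _ _ (gh _ tD); rewrite ltnS.
have injD : {in D &, injective (fun t => inord (g t * h t) : 'I_n.+1)}.
  move=> s t sD tD /(congr1 val) /=; rewrite !inordK ?ghle // => e.
  by have [? ?] := nbI _ _ _ _ (gh _ sD) (gh _ tD) e; exact: inj.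
exists [set inord (g t * h t) | t in D]; split.
- by apply/subsetP => a /imsetP[t tD ->]; have [] := nbP _ _ (gh _ tD).
- by rewrite card_in_imset.
exists x; rewrite big_imset //= -pD; apply: eq_bigr => t tD.
by rewrite inordK ?ghle.
Qed.

(** In [K_{3,3i}] each [u] lies on [3i] edges and each [v] on [3], so the product over the [9i]
    edges is a cube. *)
Lemma common_neighbours_cube n (A : {set 'I_n.+1}) nb (S : {set 'I_n.+1}) i :
  factor_graph A nb -> #|S| = 3 -> 3 * i <= #|[set v | S \subset nb v]| ->
  has_cube_subset (9 * i) A.
Proof.
move=> fg S3 /card_geqP[s [us ss sv]].
have cW : #|[set v in s]| = 3 * i by rewrite cardsE (card_uniqP us).
apply: (@factor_graph_cube _ _ _ _ (setX S [set v in s]) fst snd _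
  ((\prod_(u in S) (u : nat)) ^ i * \prod_(v in [set v in s]) (v : nat)) fg).
- move=> [u v]; rewrite !inE /= => /andP[uS /sv]; rewrite inE => /subsetP; exact.
- by move=> [a b] [c d] _ _ /= -> ->.
- by rewrite cardsX S3 cW; lia.
rewrite (eq_bigl (fun t => (t.1 \in S) && (t.2 \in [set v in s]))); last first.
  by case=> u v; rewrite in_setX.
rewrite -(pair_big (mem S) (mem [set v in s]) (fun u v => u * v)) /=.
under eq_bigr => u _ do rewrite big_split /= prod_nat_const.
rewrite big_split /= prod_nat_const cW S3 expnMn -expnM [i * 3]mulnC.
congr (_ * _).
rewrite (big_morph (fun x => x ^ (3 * i)) (id1 := 1) (op1 := muln)) // => [x y|].
  by rewrite expnMn.
by rewrite exp1n.
Qed.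

Lemma bin3_mul6 d : 6 * 'C(d, 3) = d * d.-1 * d.-2.
Proof. by rewrite mulnC (_ : 6 = 3`!) // bin_ffact !ffactnS ffactn0 muln1 mulnA. Qed.

Lemma bin3_le_cube d : 6 * 'C(d, 3) <= d ^ 3.
Proof. by rewrite bin3_mul6 !expnS expn0 muln1 mulnA !leq_mul //; lia. Qed.

Lemma cube_le_bin3 d : (d - 2) ^ 3 <= 6 * 'C(d, 3).
Proof. by rewrite bin3_mul6 !expnS expn0 muln1 mulnA !leq_mul //; lia. Qed.

(** Choose distinct vertices [w q], each adjacent to the three elements of [Q] other than [q]. This
    is [K_{4,4}] minus a perfect matching: [12] edges, three at every vertex. *)
Lemma punctured_neighbours_cube n (A : {set 'I_n.+1}) nb (Q : {set 'I_n.+1}) :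
  factor_graph A nb -> #|Q| = 4 ->
  (forall q, q \in Q -> 4 <= #|[set v | Q :\ q \subset nb v]|) ->
  has_cube_subset 12 A.
Proof.
move=> fg Q4 Qr.
have [||w [wi wQ]] := @distinct_representatives _ _
  (fun q => [set v | Q :\ q \subset nb v]) (enum Q) (enum_uniq _); last first.
(* The pair [(q, u)] stands for the edge joining [u] to [w q]. *)
- pose D := [set t : 'I_n.+1 * 'I_n.+1 | (t.1 \in Q) && (t.2 \in Q :\ t.1)].
  have sumD (R : Type) (idx : R) (op : Monoid.com_law idx) (F : 'I_n.+1 -> 'I_n.+1 -> R) :
      \big[op/idx]_(t in D) F t.1 t.2 =
      \big[op/idx]_(q in Q) \big[op/idx]_(u in Q :\ q) F q u.
    by rewrite pair_big_dep /=; apply: eq_bigl => t; rewrite inE.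
  apply: (@factor_graph_cube _ _ _ _ D snd (fun t => w t.1) _
    (\prod_(q in Q) (w q : nat) * \prod_(u in Q) (u : nat)) fg).
  + move=> [q u]; rewrite inE /= => /andP[qQ uQ].
    have := wQ q; rewrite mem_enum inE => /(_ qQ) /subsetP; exact.
  + move=> [q u] [q' u']; rewrite !inE /= => /andP[qQ _] /andP[q'Q _] -> e.
    by congr pair; apply: wi e; rewrite mem_enum.
  + rewrite -sum1_card (sumD _ _ addn (fun _ _ => 1)).
    rewrite (eq_bigr (fun=> 3)) ?sum_nat_const ?Q4 // => q qQ.
    by rewrite sum1_card; have := cardsD1 q Q; rewrite qQ Q4 => -[].
  rewrite (sumD _ _ muln (fun q u => u * w q)).
  rewrite (eq_bigr (fun q : 'I_n.+1 => (\prod_(u in Q :\ q) (u : nat)) * w q ^ 3)); last first.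
    move=> q qQ; rewrite big_split /= prod_nat_const; congr (_ * _ ^ _).
    by have := cardsD1 q Q; rewrite qQ Q4 => -[].
  rewrite big_split /= expnMn mulnC; congr (_ * _).
    by rewrite (big_morph (fun x => x ^ 3) (id1 := 1) (op1 := muln)) // => x y; rewrite expnMn.
  rewrite (exchange_big_dep (mem Q)) /=; last by move=> q u _; rewrite inE => /andP[].
  rewrite (big_morph (fun x => x ^ 3) (id1 := 1) (op1 := muln)) //; last first.
    by move=> x y; rewrite expnMn.
  apply: eq_bigr => u uQ; rewrite prod_nat_const; congr (_ ^ _).
  transitivity #|Q :\ u|; last by have := cardsD1 u Q; rewrite uQ Q4 => -[].
  by apply: eq_card => q; rewrite !inE [in RHS]eq_sym unfold_in /= !inE uQ andbT andbC.
- exact: ord0.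
by move=> q; rewrite mem_enum -cardE Q4; exact: Qr.
Qed.

(** A triple with [3i] common neighbours would give a forbidden subset, so double counting bounds
    the sum of ['C(deg v, 3)], and this dominates [(deg v - 2) ^ 3 / 6]. *)
Lemma sum_cube_excess2 n (A : {set 'I_n.+1}) nb i (I U : {set 'I_n.+1}) :
  factor_graph A nb -> ~ has_cube_subset (9 * i) A ->
  (forall v, v \in I -> nb v \subset U) ->
  \sum_(v in I) (#|nb v| - 2) ^ 3 <= (3 * i) * #|U| ^ 3.
Proof.
move=> fg nA nbU.
have H := @sum_bounded_codegree _ nb I U [set S : {set 'I_n.+1} | #|S| == 3] 3 (3 * i) nbU.
apply: (@leq_trans (6 * ((3 * i) * 'C(#|U|, 3)))); last first.
  by rewrite mulnCA leq_mul2l bin3_le_cube orbT.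
apply: leq_trans (leq_mul (leqnn 6) (H _ _)).
- rewrite big_distrr /=; apply: leq_sum => v _.
  rewrite (_ : #|[set S in _ | _]| = 'C(#|nb v|, 3)); last first.
    by rewrite -cards_draws; apply: eq_card => S; rewrite !inE andbC.
  exact: cube_le_bin3.
- by move=> S; rewrite inE => /eqP.
move=> S; rewrite inE => /eqP S3; rewrite leqNgt; apply/negP => lt.
by apply: nA; apply: common_neighbours_cube fg S3 (ltnW lt).
Qed.

(** Only triples of codegree at most [3] are counted; they form at least a quarter of the triples in
    every neighbourhood of size above [3], because a [4]-set whose four triples all had larger
    codegree would yield [12] elements with cube product. *)
Lemma sum_cube_excess3 n (A : {set 'I_n.+1}) nb (I U : {set 'I_n.+1}) :
  factor_graph A nb -> ~ has_cube_subset 12 A ->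
  (forall v, v \in I -> nb v \subset U) ->
  \sum_(v in I) (#|nb v| - 3) ^ 3 <= 12 * #|U| ^ 3.
Proof.
move=> fg nA nbU.
pose F := [set S : {set 'I_n.+1} | (#|S| == 3) && (#|[set v | S \subset nb v]| <= 3)].
have H := @sum_bounded_codegree _ nb I U F 3 3 nbU.
apply: (@leq_trans (24 * (3 * 'C(#|U|, 3)))); last first.
  rewrite (_ : 24 * _ = 12 * (6 * 'C(#|U|, 3))); last by lia.
  by rewrite leq_mul2l bin3_le_cube orbT.
apply: leq_trans (leq_mul (leqnn 24) (H _ _)); last 2 first.
- by move=> S; rewrite inE => /andP[/eqP].
- by move=> S; rewrite inE => /andP[].
rewrite big_distrr /=; apply: leq_sum => v _.
set d := #|nb v|.
case: (leqP d 3) => [d3|d3]; first by rewrite (eqP (_ : d - 3 == 0)) ?subn_eq0.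
(* Every 4-subset of a neighbourhood contains a 3-subset of small codegree. *)
have C4 : 'C(d, 4) <= (d - 3) * #|[set S in F | S \subset nb v]|.
  rewrite -cards_draws.
  have sub : [set B : {set 'I_n.+1} | B \subset nb v & #|B| == 4] \subset
     [set t.2 |: t.1 | t in [set t : {set 'I_n.+1} * 'I_n.+1 |
         (t.1 \in [set S in F | S \subset nb v]) && (t.2 \in nb v :\: t.1)]].
    apply/subsetP => Q; rewrite inE => /andP[Qv /eqP Q4].
    have [q qQ Pq] : exists2 q, q \in Q & #|[set v | Q :\ q \subset nb v]| <= 3.
      apply: contrapT => nq; apply: nA; apply: (punctured_neighbours_cube fg Q4) => q qQ.
      by rewrite ltnNge; apply/negP => h; apply: nq; exists q.
    apply/imsetP; exists (Q :\ q, q); last by rewrite setD1K.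
    rewrite !inE eqxx /= Pq (subsetP Qv) // (subset_trans (subsetDl _ _) Qv) !andbT.
    by have /eqP := cardsD1 q Q; rewrite qQ Q4 eqSS eq_sym.
  apply: leq_trans (subset_leq_card sub) _; apply: leq_trans (leq_imset_card _ _) _.
  rewrite -sum1_card.
  rewrite (eq_bigl (fun t : {set 'I_n.+1} * 'I_n.+1 =>
     (t.1 \in [set S in F | S \subset nb v]) && (t.2 \in nb v :\: t.1))); last first.
    by move=> t; rewrite inE.
  rewrite -(pair_big_dep (mem [set S in F | S \subset nb v])
     (fun S u => u \in nb v :\: S) (fun _ _ => 1)) /= mulnC -sum_nat_const.
  apply: leq_sum => S; rewrite !inE => /andP[/andP[/eqP S3 _] Sv].
  by rewrite sum1_card cardsD (setIidPr Sv) S3.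
(* The identity [4 * 'C(d, 4) = (d - 3) * 'C(d, 3)] turns [C4] into a bound for ['C(d, 3)]. *)
have C34 : (d - 3) * 'C(d, 3) <= (d - 3) * (4 * #|[set S in F | S \subset nb v]|).
  by rewrite -mul_bin_left mulnCA leq_mul2l C4 orbT.
rewrite leq_pmul2l ?subn_gt0 // in C34.
apply: leq_trans (leq_trans _ (cube_le_bin3 d)) _; first by rewrite leq_exp2r //; lia.
by apply: leq_trans (leq_mul (leqnn 6) C34) _; rewrite mulnA.
Qed.

(** * The upper bound *)

(** When [n] has order [2 ^ (6 * e)], the target [2 ^ (5 * e)] has order [n ^ (5/6)]. The range
    below [2 ^ (3 * e)] costs [s + 1] and the blocks above it form a geometric series costing
    [2 * (s + 8)], whence [3 * s + 17]. *)
Lemma sum_dyadic_le (n e s : nat) (x : nat -> nat) : n < 2 ^ (6 * e) ->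
  (forall V V', 0 < V -> \sum_(V <= v < V') x v ^ 3 <= s * (n %/ V) ^ 3) ->
  \sum_(0 <= v < 2 ^ (3 * e)) x v ^ 3 <= s * (2 ^ (3 * e)) ^ 3 ->
  \sum_(0 <= v < 2 ^ (6 * e)) x v <= (3 * s + 17) * 2 ^ (5 * e).
Proof.
move=> ne high low.
(* [a <= T + a ^ 3 / T ^ 2]; on the block [8 ^ i <= v < 8 ^ i.+1] with [e <= i] the
   choice [T = 2 ^ (6 * e - 4 * i)] balances the two terms. *)
have young T a : a * T ^ 2 <= T ^ 3 + a ^ 3.
  case: (leqP a T) => aT.
    by apply: leq_trans (leq_addr _ _); rewrite [T ^ 3]expnS leq_mul2r aT orbT.
  apply: leq_trans (leq_addl _ _); rewrite [a ^ 3]expnS leq_mul2l leq_exp2r // ltnW //.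
  by rewrite orbT.
have block V V' T : T ^ 2 * \sum_(V <= v < V') x v <=
    (V' - V) * T ^ 3 + \sum_(V <= v < V') x v ^ 3.
  rewrite big_distrr /= -sum_nat_const_nat -big_split /=.
  by apply: leq_sum => v _; rewrite mulnC young.
(* In the low range the balancing choice is [T = 2 ^ (2 * e)]. *)
have low' : \sum_(0 <= v < 2 ^ (3 * e)) x v <= (s + 1) * 2 ^ (5 * e).
  have T0 : 0 < (2 ^ (2 * e)) ^ 2 by rewrite !expn_gt0.
  rewrite -(leq_pmul2l T0); apply: leq_trans (block _ _ _) _.
  rewrite subn0; apply: leq_trans (leq_add (leqnn _) low) _.
  have -> : 2 ^ (3 * e) * (2 ^ (2 * e)) ^ 3 = (2 ^ (2 * e)) ^ 2 * 2 ^ (5 * e).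
    by rewrite -!expnM -!expnD; congr (_ ^ _); clear; lia.
  have -> : (2 ^ (3 * e)) ^ 3 = (2 ^ (2 * e)) ^ 2 * 2 ^ (5 * e).
    by rewrite -!expnM -!expnD; congr (_ ^ _); clear; lia.
  by move: ((_ ^ _) ^ 2) (2 ^ (5 * e)) => ? ?; clear; lia.
have step i : e <= i -> i < 2 * e ->
    \sum_(2 ^ (3 * i) <= v < 2 ^ (3 * i.+1)) x v <= (s + 8) * 2 ^ (6 * e - i).
  move=> ei ie.
  have nV : n %/ 2 ^ (3 * i) <= 2 ^ (6 * e - 3 * i).
    by apply: ltnW; rewrite ltn_divLR ?expn_gt0 // -expnD subnK //; lia.
  have V0 : 0 < 2 ^ (3 * i) by rewrite expn_gt0.
  have := high _ (2 ^ (3 * i.+1)) V0; move: nV; rewrite -(@leq_exp2r _ _ 3) // => nV hV.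
  have {hV} hV := leq_trans hV (leq_mul (leqnn s) nV).
  have [i6|i6] := leqP (4 * i) (6 * e).
    have T0 : 0 < (2 ^ (6 * e - 4 * i)) ^ 2 by rewrite !expn_gt0.
    rewrite -(leq_pmul2l T0); apply: leq_trans (block _ _ _) _.
    apply: leq_trans (leq_add (leq_mul (leq_subr _ _) (leqnn _)) hV) _.
    have -> : 2 ^ (3 * i.+1) * (2 ^ (6 * e - 4 * i)) ^ 3 =
       (2 ^ (6 * e - 4 * i)) ^ 2 * (8 * 2 ^ (6 * e - i)).
      by rewrite (_ : 8 = 2 ^ 3) // -!expnM -!expnD; congr (_ ^ _); move: i6 ie ei; clear; lia.
    have -> : (2 ^ (6 * e - 3 * i)) ^ 3 = (2 ^ (6 * e - 4 * i)) ^ 2 * 2 ^ (6 * e - i).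
      by rewrite -!expnM -!expnD; congr (_ ^ _); move: i6 ie ei; clear; lia.
    by move: ((_ ^ _) ^ 2) (2 ^ (6 * e - i)) => ? ?; clear; lia.
  (* For [4 * i > 6 * e] the balancing [T] would drop below [1]; here [x <= x ^ 3] suffices. *)
  apply: (@leq_trans (\sum_(2 ^ (3 * i) <= v < 2 ^ (3 * i.+1)) x v ^ 3)).
    by apply: leq_sum => v _; case: (x v) => // k; rewrite expnS leq_pmulr // expn_gt0.
  apply: leq_trans hV _; apply: leq_mul; first by lia.
  by rewrite -expnM leq_exp2l //; move: i6 ie ei; clear; lia.
(* The geometric series as an invariant: the second summand on the left is the room left for the
   blocks from [e + j] on. *)
have tail j : j <= e -> \sum_(2 ^ (3 * e) <= v < 2 ^ (3 * (e + j))) x v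
    + (s + 8) * (2 * 2 ^ (5 * e - j)) <= (s + 8) * (2 * 2 ^ (5 * e)).
  elim: j => [|j IH] je; first by rewrite addn0 subn0 big_geq.
  rewrite (@big_cat_nat _ _ _ (2 ^ (3 * (e + j)))) /=; last 2 first.
  - by rewrite leq_exp2l //; lia.
  - by rewrite leq_exp2l //; lia.
  apply: leq_trans (IH (ltnW je)); rewrite -addnA leq_add2l.
  have h : e + j < 2 * e by move: je; clear; lia.
  have := step _ (leq_addr _ _) h.
  have -> : e + j.+1 = (e + j).+1 by rewrite addnS.
  have -> : 2 ^ (5 * e - j) = 2 * 2 ^ (5 * e - j.+1).
    by rewrite -expnS; congr (_ ^ _); move: je; clear; lia.
  have -> : 6 * e - (e + j) = (5 * e - j.+1).+1 by move: je; clear; lia.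
  rewrite [2 ^ _.+1]expnS; move: (\sum_(2 ^ (3 * (e + j)) <= v < 2 ^ (3 * (e + j).+1)) x v) => ?.
  by move: (2 ^ (5 * e - j.+1)) => ?; clear; lia.
rewrite (@big_cat_nat _ _ _ (2 ^ (3 * e))) //=; last by rewrite leq_exp2l //; lia.
have := tail e (leqnn e); rewrite (_ : 3 * (e + e) = 6 * e) => [t|]; last by clear; lia.
move: low' t; move: (\sum_(2 ^ (3 * e) <= v < 2 ^ (6 * e)) x v)
  (\sum_(0 <= v < 2 ^ (3 * e)) x v) (2 ^ (5 * e - e)) (2 ^ (5 * e)).
by clear; lia.
Qed.

Definition prime_count (m : nat) : nat := #|[pred p : 'I_m.+1 | prime p]|.

Lemma sum_ord_range n (F : 'I_n.+1 -> nat) V V' :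
  \sum_(V <= v < V') (if v < n.+1 then F (inord v) else 0) =
  \sum_(v : 'I_n.+1 | V <= v < V') F v.
Proof.
pose G v := if v < n.+1 then F (inord v) else 0.
rewrite [RHS](eq_bigr (fun v : 'I_n.+1 => G v)); last first.
  by move=> v _; rewrite /G ltn_ord inord_val.
rewrite -(big_mkord (fun v => V <= v < V') G).
rewrite (big_nat_widenl V 0) // (big_nat_widen 0 V' (n.+1 + V')) ?leq_addl //.
rewrite [RHS](big_nat_widen 0 n.+1 (n.+1 + V')) ?leq_addr //.
rewrite big_mkcond [RHS]big_mkcond; apply: eq_bigr => v _; rewrite /G /=.
by case: (V <= v); case: (v < V'); case: (v < n.+1).
Qed.

Lemma card_ord_range n m : #|[set u : 'I_n.+1 | 0 < u <= m]| <= m.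
Proof.
rewrite cardE -(size_map val) -[leqRHS](size_iota 1); apply: uniq_leq_size.
  by rewrite (map_inj_uniq val_inj) enum_uniq.
by move=> _ /mapP[u + ->]; rewrite mem_enum inE mem_iota add1n ltnS.
Qed.

Lemma prime_count_widen n m : m <= n ->
  \sum_(v : 'I_n.+1 | prime v) (v <= m) = prime_count m.
Proof.
move=> mn; rewrite /prime_count -sum1_card /=.
rewrite -(big_mkord prime (fun v => (v <= m) : nat)) -(big_mkord prime (fun=> 1)).
rewrite [RHS](big_nat_widen _ _ n.+1) // big_mkcond [RHS]big_mkcond.
by apply: eq_bigr => v _; rewrite ltnS; case: (prime v); case: (v <= m).
Qed.

(** Every degree splits as [minn (deg v) r + (deg v - r)]. The excess is summed by [sum_dyadic_le];
    the truncated part gives the prime counts and an error [r * 2 ^ (5 * e)]. *)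
Lemma card_le_prime_counts n e r s (A : {set 'I_n.+1}) nb :
  n < 2 ^ (6 * e) -> factor_graph A nb ->
  (forall I U : {set 'I_n.+1}, (forall v, v \in I -> nb v \subset U) ->
     \sum_(v in I) (#|nb v| - r) ^ 3 <= s * #|U| ^ 3) ->
  #|A| <= \sum_(t < r) prime_count (n %/ t.+1) + (3 * s + 17 + r) * 2 ^ (5 * e).
Proof.
move=> ne fg Hs; have [nbP _ ->] := fg.
have nbV (v : 'I_n.+1) V : 0 < V -> V <= v -> nb v \subset [set u : 'I_n.+1 | 0 < u <= n %/ V].
  move=> V0 Vv; apply/subsetP => u /nbP[u0 _ uvn _ _]; rewrite inE u0 leq_divRL //.
  by apply: leq_trans uvn; rewrite leq_mul2l Vv orbT.
pose x v := if v < n.+1 then #|nb (inord v)| - r else 0.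
have xsum V V' : \sum_(V <= v < V') x v ^ 3 =
    \sum_(v in [set v : 'I_n.+1 | V <= v < V']) (#|nb v| - r) ^ 3.
  under [RHS]eq_bigl => v do rewrite inE.
  rewrite -[RHS](sum_ord_range (fun v => (#|nb v| - r) ^ 3)).
  by apply: eq_bigr => v _; rewrite /x; case: ifP.
have large : \sum_v (#|nb v| - r) <= (3 * s + 17) * 2 ^ (5 * e).
  rewrite (eq_bigl (fun v : 'I_n.+1 => 0 <= v < 2 ^ (6 * e))); last first.
    by move=> v; rewrite (leq_trans (ltn_ord v) ne).
  rewrite -(sum_ord_range (fun v => #|nb v| - r)).
  apply: (@sum_dyadic_le n e s x) => //.
  - move=> V V' V0; rewrite xsum.
    apply: leq_trans (Hs _ [set u : 'I_n.+1 | 0 < u <= n %/ V] _) _.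
      by move=> v; rewrite inE => /andP[Vv _]; exact: nbV.
    by rewrite leq_mul2l leq_exp2r // card_ord_range orbT.
  rewrite xsum.
  apply: leq_trans (Hs _ [set u : 'I_n.+1 | 0 < u <= 2 ^ (3 * e)] _) _.
    (* An edge has [u <= v], hence [u ^ 2 <= n], whatever [v] is. *)
    move=> v _; apply/subsetP => u /nbP[u0 uv uvn _ _]; rewrite inE u0 /=.
    rewrite -(@leq_exp2r _ _ 2) // -expnM mulnAC expnS expn1.
    by apply: leq_trans (leq_mul (leqnn u) uv) _; apply: leq_trans uvn (ltnW ne).
  by rewrite leq_mul2l leq_exp2r // card_ord_range orbT.
have small : \sum_v minn #|nb v| r <=
    \sum_(t < r) prime_count (n %/ t.+1) + r * 2 ^ (5 * e).
  rewrite (bigID (fun v : 'I_n.+1 => prime v)) /=; apply: leq_add.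
    under [leqRHS]eq_bigr => t _ do rewrite -(prime_count_widen (leq_div n t.+1)).
    rewrite exchange_big /=; apply: leq_sum => v pv.
    have v0 := prime_gt0 pv.
    have dv : #|nb v| <= n %/ v.
      by apply: leq_trans (subset_leq_card (nbV v v v0 (leqnn _))) (card_ord_range _ _).
    (* For prime [v], [deg v <= n / v], so [minn (deg v) r] is at most the number of [t < r] with
       [t.+1 <= n / v], that is [v <= n / t.+1]. *)
    apply: (@leq_trans (\sum_(t < r) (t < n %/ v))); last first.
      by apply: leq_sum => t _; rewrite !leq_divRL // mulnC.
    rewrite -(big_mkord predT (fun t => (t < n %/ v) : nat)).
    elim: r {Hs x xsum large} => [|r IH]; first by rewrite minn0.
    rewrite big_nat_recr //=; move: (n %/ v) (#|nb v|) dv IH => q d dq.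
    by move: (\sum_(0 <= i < r) _) => c; case: (ltnP r q) => /= rq; lia.
  apply: (@leq_trans (\sum_(v : 'I_n.+1 | 0 < v <= 2 ^ (5 * e)) r)).
    rewrite big_mkcond [leqRHS]big_mkcond; apply: leq_sum => v _ /=.
    case: ifP => // npv; case: (set_0Vmem (nb v)) => [->|[u uv]].
      by rewrite cards0 min0n.
    have [u0 uv' uvn _] := nbP _ _ uv; rewrite (negbTE npv) /= => v3.
    rewrite (leq_trans u0 uv') (_ : v <= _) /= ?geq_minr //.
    (* A non-prime [v] with a neighbour satisfies [v ^ 3 <= n ^ 2], hence [v <= 2 ^ (4 * e)]. *)
    apply: (@leq_trans (2 ^ (4 * e))); last by rewrite leq_exp2l //; lia.
    rewrite -(@leq_exp2r _ _ 3) // -expnM (_ : 4 * e * 3 = 6 * e * 2); last by lia.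
    by rewrite expnM; apply: leq_trans v3 _; rewrite leq_exp2r // (leq_trans uvn (ltnW ne)).
  by rewrite sum_nat_cond_const mulnC leq_mul2l card_ord_range orbT.
rewrite (eq_bigr (fun v => minn #|nb v| r + (#|nb v| - r))); last first.
  by move=> v _; lia.
rewrite big_split /=; apply: leq_trans (leq_add small large) _.
by rewrite -addnA leq_add2l -mulnDl addnC.
Qed.

(** * Realising every [k] by blocks of sizes [9i] and [12] *)

Lemma prime_count_sum_le r r' n : r <= r' ->
  \sum_(t < r) prime_count (n %/ t.+1) <= \sum_(t < r') prime_count (n %/ t.+1).
Proof.
move=> rr; rewrite -!(big_mkord predT (fun t => prime_count (n %/ t.+1))).
by rewrite [leqRHS](@big_cat_nat _ _ _ r) //= leq_addr.
Qed.

(** If [9 %| k], a single [K_{3,3i}] suffices. Otherwise [k] is [12 + 9i] or [24 + 9i] according to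
    its class modulo [9], and one or two blocks of [12] are removed first; these require the third
    prime count. *)
Lemma cube_subset_of_card (k r : nat) : 3 %| k -> 35 < k -> r = (if 9 %| k then 2 else 3) ->
  exists C, forall n e (A : {set 'I_n.+1}), n < 2 ^ (6 * e) -> ord0 \notin A ->
    \sum_(t < r) prime_count (n %/ t.+1) + C * 2 ^ (5 * e) < #|A| ->
    has_cube_subset k A.
Proof.
move=> k3 k35 rE.
have nine i n e (A : {set 'I_n.+1}) : n < 2 ^ (6 * e) -> ord0 \notin A ->
    \sum_(t < 2) prime_count (n %/ t.+1) + (3 * (3 * i) + 19) * 2 ^ (5 * e) < #|A| ->
    has_cube_subset (9 * i) A.
  move=> ne A0 lt; apply: contrapT => nA; have [nb fg] := factor_graph_exists A0.
  move: lt; rewrite ltnNge => /negP; apply.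
  have := @card_le_prime_counts n e 2 (3 * i) A nb ne fg _; rewrite -addnA; apply.
  by move=> I U; exact: (sum_cube_excess2 fg nA).
(* [56 = 3 * 12 + 17 + 3] is the constant of [card_le_prime_counts] for [s = 12] and [r = 3]. *)
have twelve n e (A : {set 'I_n.+1}) : n < 2 ^ (6 * e) -> ord0 \notin A ->
    \sum_(t < 3) prime_count (n %/ t.+1) + 56 * 2 ^ (5 * e) < #|A| ->
    has_cube_subset 12 A.
  move=> ne A0 lt; apply: contrapT => nA; have [nb fg] := factor_graph_exists A0.
  move: lt; rewrite ltnNge => /negP; apply.
  apply: (@card_le_prime_counts n e 3 12 A nb ne fg _).
  by move=> I U; exact: (sum_cube_excess3 fg nA).
(* [68 = 56 + 12]: [56] guarantees a block of [12] elements, whose removal costs [12]. *)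
have stepup i n e (A : {set 'I_n.+1}) c : n < 2 ^ (6 * e) -> ord0 \notin A ->
    \sum_(t < 3) prime_count (n %/ t.+1) + (c + 68) * 2 ^ (5 * e) < #|A| ->
    (forall B : {set 'I_n.+1}, ord0 \notin B ->
       \sum_(t < 3) prime_count (n %/ t.+1) + c * 2 ^ (5 * e) < #|B| ->
       has_cube_subset i B) ->
    has_cube_subset (12 + i) A.
  move=> ne A0 lt HB; apply: (@cube_subset_split 12 i n A) => //.
    move=> B BA AB; apply: HB.
      by apply: contra A0; apply: (subsetP BA).
    have e0 : 0 < 2 ^ (5 * e) by rewrite expn_gt0.
    move: e0 lt AB; move: (2 ^ (5 * e)) (\sum_(t < 3) _) => E P; clear; nia.
  apply: (twelve _ _ _ ne A0); apply: leq_ltn_trans lt.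
  by rewrite leq_add2l leq_mul2r; apply/orP; right; clear; lia.
have nine3 i n e (A : {set 'I_n.+1}) : n < 2 ^ (6 * e) -> ord0 \notin A ->
    \sum_(t < 3) prime_count (n %/ t.+1) + (3 * (3 * i) + 19) * 2 ^ (5 * e) < #|A| ->
    has_cube_subset (9 * i) A.
  move=> ne A0 lt; apply: (nine _ _ _ _ ne A0); apply: leq_ltn_trans lt.
  by rewrite leq_add2r prime_count_sum_le.
have [k9|k9] := boolP (9 %| k); rewrite ?k9 ?(negbTE k9) in rE; subst r.
  exists (3 * (3 * (k %/ 9)) + 19) => n e A ne A0 lt.
  rewrite -(divnK k9) mulnC; exact: nine lt.
have [i [ki|ki]] : exists i, k = 12 + 9 * i \/ k = 12 + (12 + 9 * i).
  have [k12|k12] := boolP (9 %| k - 12); first by exists ((k - 12) %/ 9); left; lia.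
  by exists ((k - 24) %/ 9); right; lia.
- exists (3 * (3 * i) + 19 + 68) => n e A ne A0 lt; rewrite ki.
  by apply: (stepup _ _ _ _ _ ne A0 lt) => B; exact: nine3.
exists (3 * (3 * i) + 19 + 68 + 68) => n e A ne A0 lt; rewrite ki.
apply: (stepup _ _ _ _ _ ne A0 lt) => B B0 ltB.
by apply: (stepup _ _ _ _ _ ne B0 ltB) => D; exact: nine3.
Qed.

(** * A Chebyshev bound *)

Lemma expn2_le_bin m : 2 ^ m <= 'C(m.*2, m).
Proof.
elim: m => // m IH; rewrite doubleS binS binS expnS.
have := leq_bin2l m (leqnSn m.*2); move: IH; clear; lia.
Qed.

Lemma divn_double_le m q : 0 < q -> m.*2 %/ q <= (m %/ q).*2 + (q <= m.*2).
Proof.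
move=> q0; have [h|h] := leqP q m.*2; last by rewrite divn_small.
rewrite addn1 -ltnS ltn_divLR // {1}(divn_eq m q).
by have := ltn_pmod m q0; rewrite -!muln2; move: (m %/ q) (m %% q) => a b; clear; nia.
Qed.

(** In Legendre's formula each power [p ^ k <= 2m] contributes at most one to the exponent and
    larger powers contribute nothing, so the exponent is at most [trunc_log p m.*2]. The [maxn 1]
    covers [m = 0]. *)
Lemma logn_bin_central p m : prime p -> p ^ logn p 'C(m.*2, m) <= maxn 1 m.*2.
Proof.
move=> pp; have p1 := prime_gt1 pp.
have [->|m0] := posnP m; first by rewrite bin0 logn1.
have M0 : 0 < m.*2 by rewrite double_gt0.
have mM : m <= m.*2 by rewrite -addnn leq_addr.
have fact : 'C(m.*2, m) * (m`! * m`!) = (m.*2)`!.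
  by have := bin_fact mM; rewrite -{2}addnn addnK.
have lM : logn p m`! = \sum_(1 <= k < m.*2.+1) m %/ p ^ k.
  rewrite logn_fact // [RHS](@big_cat_nat _ _ _ m.+1) //=.
  rewrite [X in _ + X]big_nat [X in _ + X]big1 ?addn0 // => k /andP[Mk _].
  by apply: divn_small; apply: leq_trans Mk (ltnW (ltn_expl _ p1)).
have := congr1 (logn p) fact.
rewrite !lognM ?muln_gt0 ?fact_gt0 ?bin_gt0 ?mM // lM logn_fact //.
have : \sum_(1 <= k < m.*2.+1) m.*2 %/ p ^ k <=
    \sum_(1 <= k < m.*2.+1) ((m %/ p ^ k).*2 + (p ^ k <= m.*2)).
  by apply: leq_sum => k _; apply: divn_double_le; rewrite expn_gt0 ltnW.
rewrite big_split /=.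
have -> : \sum_(1 <= k < m.*2.+1) (m %/ p ^ k).*2 = (\sum_(1 <= k < m.*2.+1) m %/ p ^ k).*2.
  by rewrite -[RHS]muln2 big_distrl; apply: eq_bigr => k _ /=; rewrite muln2.
have -> : \sum_(1 <= k < m.*2.+1) (p ^ k <= m.*2) = trunc_log p m.*2.
  have tM : trunc_log p m.*2 <= m.*2.
    by apply: leq_trans (ltnW (ltn_expl _ p1)) (trunc_logP p1 M0).
  rewrite (@big_cat_nat _ _ _ (trunc_log p m.*2).+1) //=.
  rewrite [X in _ + X]big_nat [X in _ + X]big1 ?addn0; last first.
    move=> k /andP[tk _]; apply/eqP; rewrite eqb0 -ltnNge.
    apply: leq_trans (trunc_log_ltn _ p1) _; by rewrite leq_exp2l.
  rewrite big_nat (eq_bigr (fun=> 1)) -?big_nat ?sum_nat_const_nat ?subn1 ?muln1 //.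
  move=> k /andP[_ kt]; apply/eqP; rewrite eqb1.
  by apply: leq_trans (trunc_logP p1 M0); rewrite leq_exp2l.
move=> h1 h2.
rewrite leq_max; apply/orP; right; apply: leq_trans (trunc_logP p1 M0).
by rewrite leq_exp2l //; move: h1 h2; clear; lia.
Qed.

(** The central binomial coefficient is at least [2 ^ m], and it is a product of prime powers at
    most [2m], one for each of its primes. *)
Lemma expn2_le_prime_count m : 0 < m -> 2 ^ m <= m.*2 ^ prime_count m.*2.
Proof.
move=> m0; apply: leq_trans (expn2_le_bin m) _.
have C0 : 0 < 'C(m.*2, m) by rewrite bin_gt0 -addnn leq_addr.
have m2 : maxn 1 m.*2 = m.*2 by apply/maxn_idPr; rewrite double_gt0.
rewrite {1}(prod_prime_decomp C0) prime_decompE big_map /=.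
apply: (@leq_trans (\prod_(p <- primes 'C(m.*2, m)) m.*2)).
  rewrite big_seq [leqRHS]big_seq; apply: leq_prod => p; rewrite mem_primes => /and3P[pp _ _].
  by rewrite -[leqRHS]m2; exact: logn_bin_central.
rewrite big_const_seq count_predT iter_muln_1 leq_pexp2l ?double_gt0 //.
rewrite /prime_count cardE -(size_map val); apply: uniq_leq_size; first exact: primes_uniq.
move=> p pC; have := pC; rewrite mem_primes => /and3P[pp _ _].
have pm : p < m.*2.+1.
  rewrite ltnS -m2; apply: leq_trans (logn_bin_central m pp).
  by rewrite -{1}[p]expn1 leq_exp2l ?prime_gt1 // logn_gt0.
by apply/mapP; exists (Ordinal pm); rewrite // mem_enum inE.
Qed.

(** The previous bound with [2m = 2 ^ (16 * e)]; the threshold [11] is where [e < 2 ^ (e - 7)]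
    begins to hold. The form provides two disjoint sets of [2 ^ (15 * e)] primes, with [3] to spare
    for the primes up to [3]. *)
Lemma prime_count_expn2 e : 11 <= e -> 2 ^ (15 * e).+1 + 3 <= prime_count (2 ^ (16 * e)).
Proof.
move=> e11; rewrite leqNgt; apply/negP => small.
have M0 : 0 < 2 ^ (16 * e).-1 by rewrite expn_gt0.
have Me : (2 ^ (16 * e).-1).*2 = 2 ^ (16 * e).
  by rewrite -mul2n -expnS prednK //; move: e11; clear; lia.
have := expn2_le_prime_count M0; rewrite Me -expnM leq_exp2l // leqNgt => /negP; apply.
have ee : e < 2 ^ (e - 7).
  have [i ->] : exists i, e = 11 + i by exists (e - 11); rewrite subnKC.
  rewrite (_ : 11 + i - 7 = 4 + i) ?expnD; last by clear; lia.
  by have := ltn_expl i (ltnSn 1); move: (2 ^ i) => E; clear; lia.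
apply: (@leq_ltn_trans (16 * e * 2 ^ (15 * e).+2)).
  rewrite leq_mul2l; apply/orP; right; rewrite expnS; move: small.
  have : 4 <= 2 ^ (15 * e).+1 by rewrite (_ : 4 = 2 ^ 2) // leq_exp2l //; move: e11; clear; lia.
  by move: (2 ^ (15 * e).+1) => E; clear; lia.
rewrite (_ : 2 ^ (16 * e).-1 = 16 * 2 ^ (e - 7) * 2 ^ (15 * e).+2).
  by rewrite ltn_pmul2r ?expn_gt0 // ltn_pmul2l.
by rewrite (_ : 16 = 2 ^ 4) // -!expnD; congr (_ ^ _); move: e11; clear; lia.
Qed.

(** * Random sets of products of two primes *)

(** A map [c] models the random set of its zeros, each point being chosen independently with
    probability [1 / q.+1]; counted are the outcomes that contain [B]. *)
Lemma card_ffun_vanishing (T : finType) q (B : {set T}) :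
  #|[set c : {ffun T -> 'I_q.+1} | [forall x in B, c x == ord0]]| = q.+1 ^ (#|T| - #|B|).
Proof.
rewrite (_ : #|T| - #|B| = #|~: B|); last by rewrite [RHS]cardsCs setCK.
rewrite -[q.+1 in RHS]card_ord cardsE.
rewrite -(card_pffun_on (ord0 : 'I_q.+1) (mem (~: B)) (mem predT)); apply: eq_card => c.
rewrite unfold_in; apply/forall_inP/pffun_onP => [c0|[sB _] x xB].
  split=> //; apply/subsetP => x; rewrite !inE; apply: contra => xB.
  by rewrite c0.
apply: contraLR xB => cx; have := subsetP sB x; rewrite !inE; exact.
Qed.

(* Deletion method: average over a random subset of density [1 / q]. *)
Lemma large_subset_avoiding (T : finType) q C (U : {set T}) (F : {set {set T}}) : 0 < q ->
  (forall B, B \in F -> B != set0) ->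
  \sum_(B in F) q ^ (#|T| - #|B|) <= C * q ^ #|T| ->
  exists X : {set T}, [/\ X \subset U, forall B, B \in F -> ~~ (B \subset X)
    & #|U| <= q * (#|X| + C)].
Proof.
case: q => // q _ F0 FC.
pose Z (c : {ffun T -> 'I_q.+1}) := [set x | c x == ord0].
have BZ (B : {set T}) c : (B \subset Z c) = [forall x in B, c x == ord0].
  apply/subsetP/forall_inP => h x xB; first by have := h _ xB; rewrite inE.
  by rewrite inE h.
(* Averaging over [c]: the mean of [#|U :&: Z c|] is [#|U| / q.+1] and the mean number of bad sets
   inside [Z c] is at most [C]. *)
have [c hc] : exists c, #|U| + q.+1 * #|[set B in F | B \subset Z c]| <=
    q.+1 * (#|U :&: Z c| + C).
  apply: contrapT => nc.
  have : \sum_(c : {ffun T -> 'I_q.+1}) q.+1 * (#|U :&: Z c| + C) <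
         \sum_(c : {ffun T -> 'I_q.+1}) (#|U| + q.+1 * #|[set B in F | B \subset Z c]|).
    have lt (c : {ffun T -> 'I_q.+1}) : q.+1 * (#|U :&: Z c| + C) <
        #|U| + q.+1 * #|[set B in F | B \subset Z c]|.
      by rewrite ltnNge; apply/negP => h; apply: nc; exists c.
    rewrite (bigD1 [ffun=> ord0]) // [ltnRHS](bigD1 [ffun=> ord0]) //=.
    by rewrite -addSn leq_add ?lt //; apply: leq_sum => c _; apply: ltnW.
  rewrite ltnNge => /negP; apply.
  rewrite big_split /= -!big_distrr /= big_split /= mulnDr.
  have cf : #|{: {ffun T -> 'I_q.+1}}| = q.+1 ^ #|T| by rewrite card_ffun card_ord.
  rewrite !sum_nat_const cf; apply: leq_add.
    have -> : \sum_(c : {ffun T -> 'I_q.+1}) #|U :&: Z c| = #|U| * q.+1 ^ #|T|.-1.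
      under eq_bigr => c _ do rewrite -sum1_card.
      rewrite (exchange_big_dep (mem U)) /=; last by move=> c x _; rewrite inE => /andP[].
      rewrite -sum_nat_const; apply: eq_bigr => x xU.
      rewrite sum1dep_card -subn1 -(cards1 x) -card_ffun_vanishing.
      apply: eq_card => c; rewrite !inE xU /=.
      apply/eqP/forall_inP => [cx y|]; first by rewrite inE => /eqP ->; rewrite cx.
      by move/(_ x); rewrite inE eqxx => /(_ isT)/eqP.
    case: (set_0Vmem U) => [->|[x xU]]; first by rewrite cards0 muln0.
    by rewrite mulnCA -expnS prednK ?leqnn 1?mulnC //; apply/card_gt0P; exists x.
  rewrite leq_mul2l /= [leqRHS]mulnC; apply: leq_trans FC.
  under eq_bigr => c _ do rewrite -sum1dep_card.
  rewrite (exchange_big_dep (mem F)) /=; last by move=> c B _ /andP[].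
  apply: leq_sum => B BF; rewrite sum1dep_card -card_ffun_vanishing.
  by apply: subset_leq_card; apply/subsetP => c; rewrite !inE => /andP[_]; rewrite BZ.
(* Picking a point from every bad set needs a default; if [T] is empty, the empty set works. *)
have [T0|x0] : (T -> False) + T.
  by case: (pickP (@predT T)) => [x _|h]; [right|left => x; have := h x].
  exists set0; rewrite sub0set; split=> // [B BF|].
    by rewrite subset0 F0.
  rewrite (_ : U = set0) ?cards0 //; apply/setP => x; case: (T0 x).
pose pk (B : {set T}) := odflt x0 [pick x in B].
have pkB B : B \in F -> pk B \in B.
  move=> /F0 /set0Pn[x xB]; rewrite /pk; case: pickP => //= h.
  by have := h x; rewrite xB.
(* One point of each bad set inside [Z c]; deleting these destroys all bad sets. *)
pose D := [set pk B | B in [set B in F | B \subset Z c]].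
exists ((U :&: Z c) :\: D); split.
- by apply: subset_trans (subsetDl _ _) (subsetIl _ _).
- move=> B BF; apply/negP => /subsetP BX.
  have := BX _ (pkB _ BF); rewrite inE => /andP[/negP]; case; apply/imsetP; exists B => //.
  by rewrite inE BF; apply/subsetP => x /BX; rewrite !inE => /andP[_ /andP[]].
have DD : #|D| <= #|[set B in F | B \subset Z c]| by apply: leq_imset_card.
have := cardsD (U :&: Z c) D; have := subset_leq_card (subsetIr (U :&: Z c) D).
by move: hc DD; clear; nia.
Qed.

(** * Products of two primes and their cube subsets *)

Lemma logn_prod_pos (I : finType) (A : {set I}) (F : I -> nat) p :
  (forall i, i \in A -> 0 < F i) ->
  logn p (\prod_(i in A) F i) = \sum_(i in A) logn p (F i).
Proof.
move=> F0.
suff [] : 0 < \prod_(i in A) F i /\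
  logn p (\prod_(i in A) F i) = \sum_(i in A) logn p (F i) by [].
apply: (big_ind2 (fun x y => 0 < x /\ logn p x = y)); first by rewrite logn1.
  by move=> x a y b [x0 <-] [y0 <-]; rewrite muln_gt0 x0 y0 lognM.
by move=> i iA; rewrite F0.
Qed.

(** Factors from disjoint sets of primes make the products squarefree, and a product determines its
    pair. *)
Definition prime_pair n (P1 P2 : {set 'I_n.+1}) : Prop :=
  [/\ forall p, p \in P1 :|: P2 -> prime p, [disjoint P1 & P2]
    & forall p q, p \in P1 -> q \in P2 -> p * q <= n].

Definition prime_products n (P1 P2 : {set 'I_n.+1}) : {set 'I_n.+1} :=
  [set inord (p * q) | p : 'I_n.+1 in P1, q : 'I_n.+1 in P2].

Lemma prime_productsP n (P1 P2 : {set 'I_n.+1}) (b : 'I_n.+1) : prime_pair P1 P2 ->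
  b \in prime_products P1 P2 ->
  exists p q : 'I_n.+1, [/\ p \in P1, q \in P2, p != q, b = p * q :> nat
    & forall r, prime r -> logn r b = (r == p) + (r == q)].
Proof.
move=> [Pp Pd Pn] /imset2P[p q pP qP ->]; exists p, q.
have bE : (inord (p * q) : 'I_n.+1) = p * q :> nat by rewrite inordK // ltnS Pn.
have pq : p != q by apply/eqP => e; move: Pd => /pred0P/(_ p) /=; rewrite pP e qP.
have pp : prime p by apply: Pp; rewrite inE pP.
have qp : prime q by apply: Pp; rewrite inE qP orbT.
by split=> // r rp; rewrite bE lognM ?prime_gt0 // !logn_prime.
Qed.

Lemma card_prime_products n (P1 P2 : {set 'I_n.+1}) : prime_pair P1 P2 ->
  #|prime_products P1 P2| = #|P1| * #|P2|.
Proof.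
move=> [Pp Pd Pn]; rewrite /prime_products curry_imset2X card_in_imset ?cardsX //.
move=> [p q] [p' q']; rewrite !inE /= => /andP[pP qP] /andP[p'P q'P] /(congr1 val).
rewrite /= !inordK ?ltnS ?Pn // => e.
have pp : prime p by apply: Pp; rewrite inE pP.
have p'p : prime p' by apply: Pp; rewrite inE p'P.
have q'p : prime q' by apply: Pp; rewrite inE q'P orbT.
have : p %| p' * q' by rewrite -e dvdn_mulr.
rewrite Euclid_dvdM // !dvdn_prime2 // => /orP[/eqP/val_inj pE|/eqP/val_inj pE].
  by move: e; rewrite pE => /eqP; rewrite eqn_pmul2l ?prime_gt0 // => /eqP/val_inj ->.
by move: Pd => /pred0P/(_ p) /=; rewrite pP pE q'P.
Qed.

(** A prime occurring in a cube occurs at least three times, and [j] products carry [2 * j] prime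
    factors, so at most [m = 2 * j / 3] primes are involved. The subset is recovered from a list of
    [m] primes and a set of pairs of positions in it. *)
Lemma card_cube_subsets n (P1 P2 : {set 'I_n.+1}) j : prime_pair P1 P2 -> 0 < j ->
  #|[set B : {set 'I_n.+1} | [&& B \subset prime_products P1 P2, #|B| == j &
      `[< exists x : nat, \prod_(a in B) (a : nat) = x ^ 3 >]]]|
    <= (#|P1| + #|P2|) ^ (2 * j %/ 3) * 2 ^ ((2 * j %/ 3) * (2 * j %/ 3)).
Proof.
move=> PP j0; have [Pp Pd Pn] := PP; set m := 2 * j %/ 3; set P := P1 :|: P2.
have cP : #|P1| + #|P2| = #|P| by rewrite /P cardsU disjoint_setI0 // cards0 subn0.
pose Phi (t : {ffun 'I_m -> 'I_n.+1} * {set 'I_m * 'I_m}) : {set 'I_n.+1} :=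
  [set inord (t.1 z.1 * t.1 z.2) | z in t.2].
apply: (@leq_trans #|Phi @: setX [set h | h \in ffun_on P] setT|); last first.
  apply: leq_trans (leq_imset_card _ _) _.
  rewrite cardsX cardsE card_ffun_on card_ord cP.
  by rewrite -powersetT card_powerset cardsT card_prod card_ord leqnn.
apply: subset_leq_card; apply/subsetP => B; rewrite inE.
move=> /and3P[/subsetP BU /eqP Bj /asboolP[x Bx]].
pose S := [set p in P | [exists b in B, p %| (b : nat)]].
have bP (b : 'I_n.+1) : b \in B -> exists p q : 'I_n.+1,
    [/\ p \in P1, q \in P2, p != q, b = p * q :> nat
    & forall r, prime r -> logn r b = (r == p) + (r == q)].
  by move=> /BU; exact: prime_productsP.
have b0 (b : 'I_n.+1) : b \in B -> 0 < b.
  move=> /bP[p [q [pP qP _ -> _]]].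
  have pp : prime p by apply: Pp; rewrite inE pP.
  have qp : prime q by apply: Pp; rewrite inE qP orbT.
  by rewrite muln_gt0 !prime_gt0.
have SP p : p \in S -> p \in P by rewrite inE => /andP[].
have one (p : 'I_n.+1) : \sum_(r in S) (r == p) <= 1.
  rewrite (eq_bigr (fun r => if r == p then 1 else 0)) -?big_mkcondr; last by move=> r _; case: eqP.
  rewrite sum1_card -(card1 p); apply: subset_leq_card; apply/subsetP => r.
  by rewrite !inE unfold_in => /andP[].
have Sm : #|S| <= m.
  rewrite /m leq_divRL // -sum_nat_const.
  apply: (@leq_trans (\sum_(p in S) \sum_(b in B) logn p b)).
    apply: leq_sum => p; rewrite inE => /andP[pP /exists_inP[b bB pb]].
    have pp := Pp _ pP; rewrite -logn_prod_pos // Bx lognX.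
    have : 0 < logn p (\prod_(a in B) (a : nat)).
      rewrite logn_prod_pos // (bigD1 b) //= addn_gt0; apply/orP; left.
      by rewrite logn_gt0 mem_primes pp b0.
    by rewrite Bx lognX; case: (logn p x) => // k _; rewrite mulnS.
  rewrite exchange_big /= -Bj mulnC -sum_nat_const; apply: leq_sum => b /bP[p [q [_ _ _ _ lb]]].
  rewrite (eq_bigr (fun r : 'I_n.+1 => (r == p) + (r == q) : nat)); last first.
    by move=> r rS; rewrite lb // Pp // SP.
  rewrite big_split /= -[2]/(1 + 1); exact: leq_add.
have [b bB] : exists b, b \in B by apply/card_gt0P; rewrite Bj.
have inS (c p : 'I_n.+1) : c \in B -> p \in P -> p %| c -> p \in S.
  by move=> cB pP pc; rewrite inE pP; apply/exists_inP; exists c.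
have [p0 p0S] : exists p0, p0 \in S.
  have [p [q [pP _ _ bE _]]] := bP _ bB; exists p; apply: (inS b) => //.
    by rewrite inE pP.
  by rewrite bE dvdn_mulr.
(* Positions beyond [#|S|] repeat [p0], so that the list has length exactly [m]. *)
pose h := [ffun i : 'I_m => nth p0 (enum S) i].
have hS i : h i \in S.
  rewrite ffunE; have [lt|ge] := ltnP i (size (enum S)); last by rewrite nth_default.
  by rewrite -mem_enum mem_nth.
have hK p : p \in S -> exists i, h i = p.
  move=> pS; have lt : index p (enum S) < m.
    by apply: leq_trans Sm; rewrite cardE index_mem mem_enum.
  by exists (Ordinal lt); rewrite ffunE nth_index // mem_enum.
apply/imsetP; exists (h, [set z | inord (h z.1 * h z.2) \in B]).
  by rewrite !inE andbT; apply/ffun_onP => i; apply: SP.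
apply/setP => c; apply/idP/imsetP => [cB|[z]]; last by rewrite inE => + ->.
have [p [q [pP qP _ cE _]]] := bP _ cB.
have [i hi] : exists i, h i = p.
  by apply/hK/(inS c) => //; rewrite ?cE ?dvdn_mulr // inE pP.
have [k hk] : exists i, h i = q.
  by apply/hK/(inS c) => //; rewrite ?cE ?dvdn_mull // inE qP orbT.
have cE' : c = inord (h i * h k) by rewrite hi hk -cE inord_val.
by exists (i, k); rewrite ?inE /= -?cE'.
Qed.

(** Density [2 ^ (- 10 * e)] keeps about [2 ^ (20 * e)] of the [2 ^ (30 * e)] products. The powers
    of [2 ^ e] in the expected number of bad [j]-subsets cancel or are negative, since
    [15 * m <= 10 * j]. *)
Lemma large_cube_free_subset k : exists C, forall n e (P1 P2 : {set 'I_n.+1}),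
  prime_pair P1 P2 -> #|P1| = 2 ^ (15 * e) -> #|P2| = 2 ^ (15 * e) ->
  exists X : {set 'I_n.+1}, [/\ X \subset prime_products P1 P2,
    forall B : {set 'I_n.+1}, B \subset X -> 0 < #|B| <= k ->
      ~ exists x, \prod_(a in B) (a : nat) = x ^ 3
    & 2 ^ (20 * e) <= #|X| + C].
Proof.
(* There are [k.+1] sizes [j], each with at most [2 ^ (k + k * k)] bad subsets on average. *)
exists (k.+1 * 2 ^ (k + k * k)) => n e P1 P2 PP c1 c2.
pose F := [set B : {set 'I_n.+1} | [&& B \subset prime_products P1 P2, 0 < #|B| <= k &
      `[< exists x : nat, \prod_(a in B) (a : nat) = x ^ 3 >]]].
have [||| X [XU XF XC]] := @large_subset_avoiding _ (2 ^ (10 * e))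
  (k.+1 * 2 ^ (k + k * k)) (prime_products P1 P2) F.
- by rewrite expn_gt0.
- by move=> B; rewrite inE => /and3P[_ /andP[B0 _] _]; rewrite -card_gt0.
- rewrite (partition_big (fun B : {set 'I_n.+1} => inord #|B| : 'I_k.+1) predT) //=.
  rewrite -mulnA -[k.+1 in leqRHS]card_ord -sum_nat_const; apply: leq_sum => j _.
  have Fj (B : {set 'I_n.+1}) : (B \in F) && (inord #|B| == j) -> #|B| = j.
    by rewrite inE => /andP[/and3P[_ /andP[_ Bk] _] /eqP <-]; rewrite inordK.
  have [jK|Kj] := leqP j #|'I_n.+1|; last first.
    by rewrite big_pred0 // => B; apply/negP => /Fj Bj; move: Kj; rewrite -Bj ltnNge max_card.
  have [j0|j0] := posnP j.
    rewrite big_pred0 // => B; apply/negP => BF; have := Fj _ BF; rewrite j0 => B0.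
    by move: BF; rewrite inE B0 andbF.
  rewrite (eq_bigr (fun=> (2 ^ (10 * e)) ^ (#|'I_n.+1| - j))); last by move=> B /Fj ->.
  rewrite sum_nat_cond_const.
  have jk : j <= k by rewrite -ltnS.
  set m := 2 * j %/ 3; have mj : 3 * m <= 2 * j by rewrite mulnC leq_trunc_div.
  apply: (@leq_trans ((2 * 2 ^ (15 * e)) ^ m * 2 ^ (m * m) * (2 ^ (10 * e)) ^ (#|'I_n.+1| - j))).
    rewrite leq_mul2r; apply/orP; right.
    have := card_cube_subsets PP j0; rewrite c1 c2 -/m addnn -mul2n; apply: leq_trans.
    apply: subset_leq_card; apply/subsetP => B; rewrite inE => BF; rewrite inE (Fj _ BF) eqxx.
    by move: BF; rewrite inE => /andP[/and3P[-> _ ->]].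
  rewrite -expnS -!expnM -!expnD leq_exp2l // mulSn -[in leqRHS](subnK jK) mulnDr.
  have mk : m <= k by move: mj jk; clear; lia.
  have mm : m * m <= k * k by exact: leq_mul.
  have em : 15 * e * m <= 10 * e * j.
    rewrite (_ : 15 * e * m = 5 * e * (3 * m)); last by clear; lia.
    rewrite (_ : 10 * e * j = 5 * e * (2 * j)); last by clear; lia.
    by rewrite leq_mul2l mj orbT.
  by move: (10 * e * (_ - j)) (15 * e * m) (10 * e * j) (m * m) (k * k) em mm mk; clear; lia.
exists X; split=> //.
- move=> B BX Bk cB; have := XF B; rewrite BX inE Bk (subset_trans BX XU) /=.
  by move=> /(_ (introT (asboolP _) cB)).
move: XC; rewrite card_prime_products // c1 c2 -expnD.
rewrite (_ : 15 * e + 15 * e = 10 * e + 20 * e); last by clear; lia.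
by rewrite expnD leq_pmul2l ?expn_gt0.
Qed.

Lemma subset_of_card (T : finType) (A : {set T}) k : k <= #|A| ->
  exists2 B : {set T}, B \subset A & #|B| = k.
Proof.
move=> /card_geqP[s [us ss sA]]; exists [set x in s].
  by apply/subsetP => x; rewrite inE; exact: sA.
by rewrite cardsE (card_uniqP us).
Qed.

Lemma prime_pair_exists n e : 11 <= e -> 2 ^ (32 * e) <= n ->
  exists P1 P2 : {set 'I_n.+1}, [/\ prime_pair P1 P2, #|P1| = 2 ^ (15 * e),
    #|P2| = 2 ^ (15 * e) & forall p, p \in P1 :|: P2 -> 3 < p <= 2 ^ (16 * e)].
Proof.
move=> e11 en.
have M2 : 2 ^ (16 * e) * 2 ^ (16 * e) <= n.
  by rewrite -expnD (_ : 16 * e + 16 * e = 32 * e) //; clear; lia.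
have Mn : 2 ^ (16 * e) <= n by apply: leq_trans M2; rewrite leq_pmulr // expn_gt0.
pose P := [set p : 'I_n.+1 | prime p && (3 < p <= 2 ^ (16 * e))].
have cP : 2 ^ (15 * e).+1 <= #|P|.
  have := prime_count_expn2 e11; rewrite -(prime_count_widen Mn) -sum1_card.
  have small : \sum_(v : 'I_n.+1) (0 < v <= 3 : nat) <= 3.
    rewrite (eq_bigr (fun v : 'I_n.+1 => if 0 < v <= 3 then 1 else 0)) => [|v _]; last by case: ifP.
    by rewrite -big_mkcond sum1dep_card card_ord_range.
  have : \sum_(v : 'I_n.+1 | prime v) (v <= 2 ^ (16 * e)) <=
      \sum_(i in P) 1 + \sum_(v : 'I_n.+1) (0 < v <= 3 : nat).
    rewrite big_mkcond [\sum_(i in P) 1]big_mkcond -big_split /=; apply: leq_sum => v _.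
    rewrite inE; case: (boolP (prime v)) => //= /prime_gt0 ->.
    by rewrite [3 < v]ltnNge; case: (v <= 3); case: (v <= _).
  by move: small => + h1 h2; move: h1 h2; rewrite !sum1_card; lia.
have [P1 P1P c1] : exists2 B : {set 'I_n.+1}, B \subset P & #|B| = 2 ^ (15 * e).
  by apply: subset_of_card; apply: leq_trans cP; rewrite leq_exp2l.
have [P2 P2P c2] : exists2 B : {set 'I_n.+1}, B \subset P :\: P1 & #|B| = 2 ^ (15 * e).
  apply: subset_of_card; rewrite cardsD (setIidPr P1P) c1 leq_subRL.
    by rewrite addnn -mul2n -expnS.
  by rewrite -c1 subset_leq_card.
have PP p : p \in P1 :|: P2 -> p \in P.
  by rewrite inE => /orP[/(subsetP P1P)|/(subsetP P2P)] //; rewrite inE => /andP[].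
exists P1, P2; split=> //.
  split.
  - by move=> p /PP; rewrite inE => /andP[].
  - rewrite disjoint_sym; apply: disjointWl P2P _.
    by apply/pred0P => p /=; rewrite inE; case: (p \in P1); rewrite ?andbF.
  - move=> p q pP qP; apply: leq_trans M2.
    have := PP p; have := PP q; rewrite !inE pP qP orbT.
    move=> /(_ isT)/and3P[_ _ ?] /(_ isT)/and3P[_ _ ?].
    exact: leq_mul.
by move=> p /PP; rewrite inE => /andP[].
Qed.

(** * The lower bound *)

(** As ['I_R] starts at [0], the pair [(t, p)] stands for the multiple [t.+1 * p]. *)
Definition prime_multiple_index n R M : {set 'I_R * 'I_n.+1} :=
  [set z : 'I_R * 'I_n.+1 | [&& prime z.2, M < z.2 & z.1.+1 * z.2 <= n]].

Definition prime_multiple n R (z : 'I_R * 'I_n.+1) : 'I_n.+1 := inord (z.1.+1 * z.2).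

(** A multiplier is at most [R <= M < p], so the large prime can be read off from the multiple. *)
Lemma prime_multiple_inj n R M : R <= M ->
  {in prime_multiple_index n R M &, injective (@prime_multiple n R)}.
Proof.
move=> RM [t p] [u q]; rewrite !inE /= => /and3P[pp Mp tpn] /and3P[pq Mq uqn].
move=> /(congr1 val); rewrite /= !inordK ?ltnS // => e.
have pE : p = q.
  have : p %| u.+1 * q by rewrite -e dvdn_mull.
  rewrite Euclid_dvdM // => /orP[/dvdn_leq|]; last by rewrite dvdn_prime2 // => /eqP/val_inj.
  by move=> /(_ isT) pu; have := ltn_ord u; move: RM Mp pu; clear; lia.
move: e; rewrite pE => /eqP; rewrite eqn_pmul2r ?prime_gt0 // => /eqP[] /val_inj ->.
by [].
Qed.

(** Restricting to primes above [M] loses at most [M] of them for each of the [R] multipliers. *)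
Lemma card_prime_multiples n R M : R <= M ->
  \sum_(t < R) prime_count (n %/ t.+1) <=
  #|@prime_multiple n R @: prime_multiple_index n R M| + R * M.
Proof.
move=> RM; rewrite card_in_imset; last exact: prime_multiple_inj.
have -> : #|prime_multiple_index n R M| =
    \sum_(t < R) \sum_(p : 'I_n.+1 | prime p && (M < p) && (p <= n %/ t.+1)) 1.
  rewrite pair_big_dep /= -sum1_card; apply: eq_bigl => -[t p]; rewrite inE /=.
  by rewrite leq_divRL // mulnC andbA.
rewrite -[R in R * M]card_ord -sum_nat_const -big_split /=; apply: leq_sum => t _.
rewrite -(prime_count_widen (leq_div n t.+1)).
apply: (@leq_trans (\sum_(p : 'I_n.+1 | prime p && (M < p) && (p <= n %/ t.+1)) 1
   + \sum_(p : 'I_n.+1 | 0 < p <= M) 1)); last first.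
  by rewrite leq_add2l sum1dep_card card_ord_range.
rewrite big_mkcond [X in _ <= X + _]big_mkcond [X in _ <= _ + X]big_mkcond -big_split /=.
apply: leq_sum => p _; case: (boolP (prime p)) => //= /prime_gt0 ->.
by rewrite ltnNge; case: (p <= M); case: (p <= n %/ t.+1).
Qed.

(** A prime above [M] divides only its own multiples, each exactly once, so [S] contains none or
    three of them. In the second case [R = 3], and the part of [S] outside [X] turns out to be a
    cube of [9i] elements, which leaves a cube on [S :&: X]. *)
Lemma cube_subset_restrict n R M (X S : {set 'I_n.+1}) x : 3 <= M -> 2 <= R <= 3 ->
  (forall b, b \in X -> [/\ 0 < b, ~~ (2 %| b) & forall p, prime p -> M < p -> ~~ (p %| b)]) ->
  S \subset X :|: @prime_multiple n R @: prime_multiple_index n R M ->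
  \prod_(a in S) (a : nat) = x ^ 3 ->
  exists i, [/\ #|S| = #|S :&: X| + 9 * i, R = 2 -> i = 0 &
    exists y, \prod_(a in S :&: X) (a : nat) = y ^ 3].
Proof.
move=> M3 R23 XP SA Sx.
have RM : R <= M by move: M3 R23; clear; lia.
pose D := prime_multiple_index n R M.
have Dv z : z \in D -> prime_multiple z = z.1.+1 * z.2 :> nat.
  by rewrite inE => /and3P[_ _ ?]; rewrite inordK.
have Dp z : z \in D -> prime z.2 /\ M < z.2 by rewrite inE => /and3P[].
have XD z : z \in D -> prime_multiple z \notin X.
  move=> zD; have [zp zM] := Dp _ zD; apply/negP => /XP[_ _ /(_ _ zp zM)].
  by rewrite Dv // dvdn_mull.
pose E := [set z in D | prime_multiple z \in S].
have ED z : z \in E -> z \in D by rewrite inE => /andP[].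
have injE : {in E &, injective (@prime_multiple n R)}.
  by move=> z w /ED zD /ED wD; exact: (prime_multiple_inj RM).
have SE : S :\: X = @prime_multiple n R @: E.
  apply/setP => a; apply/setDP/imsetP => [[aS aX]|[z]].
    have := subsetP SA _ aS; rewrite inE (negbTE aX) /= => /imsetP[z zD aE].
    by exists z => //; rewrite inE zD -aE.
  by rewrite inE => /andP[zD zS] ->; rewrite zS XD.
have split (T : Type) (idx : T) (op : Monoid.com_law idx) (F : nat -> T) :
    \big[op/idx]_(a in S) F a =
    op (\big[op/idx]_(a in S :&: X) F a) (\big[op/idx]_(z in E) F (z.1.+1 * z.2)).
  rewrite (big_setID X) /= SE big_imset //=; congr (op _ _).
  by apply: eq_bigr => z /ED zD; rewrite Dv.
have S0 a : a \in S -> 0 < a.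
  move=> aS; case: (boolP (a \in X)) => [/XP[]//|aX].
  have : a \in S :\: X by rewrite inE aX.
  rewrite SE => /imsetP[z /ED zD ->]; rewrite Dv //.
  by have [/prime_gt0 z0 _] := Dp _ zD; rewrite muln_gt0.
have logS p : 3 %| \sum_(a in S) logn p a.
  by rewrite -logn_prod_pos // Sx lognX dvdn_mulr.
have fibre p : prime p -> M < p -> 3 %| #|[set z in E | z.2 == p :> nat]|.
  move=> pp Mp; have := logS p; rewrite (split _ 0 addn) big1 ?add0n; last first.
    move=> a; rewrite inE => /andP[_ /XP[a0 _ /(_ _ pp Mp) pa]].
    by apply/eqP; rewrite -leqn0 leqNgt logn_gt0 mem_primes pp a0.
  rewrite (eq_bigr (fun z : 'I_R * 'I_n.+1 => if z.2 == p :> nat then 1 else 0)) => [|z /ED zD].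
    rewrite -big_mkcondr sum1_card; congr (_ %| _); apply: eq_card => z.
    by rewrite inE unfold_in.
  have [zp zM] := Dp _ zD.
  rewrite (lognM p (ltn0Sn _) (prime_gt0 zp)) (logn_prime p zp) [p == _]eq_sym.
  rewrite (_ : logn p z.1.+1 = 0) ?add0n; first by case: eqP.
  apply/eqP; rewrite -leqn0 leqNgt logn_gt0 mem_primes pp /=; apply/negP => /dvdn_leq.
  by move=> /(_ isT); have := ltn_ord z.1; move: RM Mp; clear; lia.
(* At least three distinct multipliers occur with the prime of [z], and ['I_R] has at most three
   elements. *)
have full z : z \in E -> R = 3 /\ forall t, (t, z.2) \in E.
  move=> zE; have [zp zM] := Dp _ (ED _ zE).
  set Ez := [set w in E | w.2 == z.2].
  have E3 : 3 <= #|Ez|.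
    apply: dvdn_leq; last exact: fibre.
    by apply/card_gt0P; exists z; rewrite inE zE eqxx.
  have fi : {in Ez &, injective (fst : 'I_R * 'I_n.+1 -> 'I_R)}.
    move=> [t p] [u q]; rewrite !inE => /andP[_ /eqP/= ->] /andP[_ /eqP/= ->] /= ->.
    by [].
  have cf := card_in_imset fi.
  have R3 : R = 3.
    have : #|fst @: Ez| <= R by rewrite -[leqRHS]card_ord max_card.
    by rewrite cf; move: E3 R23; clear; lia.
  split=> // t.
  have /eqP fT : fst @: Ez == setT.
    by rewrite eqEcard subsetT cardsT card_ord cf (leq_trans _ E3) // R3.
  have : t \in fst @: Ez by rewrite fT.
  by case/imsetP => -[u q]; rewrite inE => /andP[uE /eqP/= <-] /= ->.
have [E0|[z zE]] := set_0Vmem E.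
  have SX : S :&: X = S.
    by apply/setIidPl; rewrite -setD_eq0 SE E0 imset0.
  by exists 0; rewrite SX muln0 addn0; split=> //; exists x.
have [R3 _] := full z zE.
subst R.
pose Q := [set w.2 | w in E].
have EQ : E = setX setT Q.
  apply/setP => -[t p]; rewrite in_setX in_setT /=; apply/idP/imsetP => [tE|[w wE pE]].
    by exists (t, p).
  by have [_ /(_ t)] := full _ wE; rewrite -pE.
have prodE : \prod_(w in E) (w.1.+1 * w.2) = 6 ^ #|Q| * (\prod_(p in Q) (p : nat)) ^ 3.
  rewrite EQ (eq_bigl (fun w => (w.1 \in setT) && (w.2 \in Q))); last first.
    by case=> t p; rewrite in_setX.
  rewrite -(pair_big (mem setT) (mem Q) (fun (t : 'I_3) (p : 'I_n.+1) => t.+1 * p)) /=.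
  rewrite exchange_big /=.
  rewrite (eq_bigr (fun p : 'I_n.+1 => 6 * p ^ 3)); last first.
    move=> p _; rewrite big_split /= prod_nat_const cardsT card_ord; congr (_ * _).
    by rewrite (eq_bigl predT) ?big_ord_recl ?big_ord0 // => t; rewrite inE.
  rewrite big_split /= prod_nat_const; congr (_ * _).
  by rewrite (big_morph (fun x => x ^ 3) (id1 := 1) (op1 := muln)) // => u v; rewrite expnMn.
have prodS := split _ 1 muln id; rewrite Sx prodE in prodS.
have Q0 : 0 < \prod_(p in Q) (p : nat).
  apply: prodn_cond_gt0 => p /imsetP[w /ED wD ->].
  by have [/prime_gt0 ? _] := Dp _ wD.
have X0 : 0 < \prod_(a in S :&: X) (a : nat).
  by apply: prodn_cond_gt0 => a; rewrite inE => /andP[/S0].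
(* Elements of [X] are odd, so the exponent of [2] in the product is [#|Q|] modulo [3]. *)
have Q3 : 3 %| #|Q|.
  have := congr1 (logn 2) prodS.
  rewrite lognX lognM // ?muln_gt0 ?expn_gt0 ?Q0 // lognM ?expn_gt0 ?Q0 // !lognX.
  rewrite (@logn_prod_pos _ (S :&: X)); last by move=> a; rewrite inE => /andP[/S0].
  rewrite big1; last first.
    move=> a; rewrite inE => /andP[_ /XP[a0 a2 _]].
    by apply/eqP; rewrite -leqn0 leqNgt logn_gt0 mem_primes a0.
  rewrite (_ : logn 2 6 = 1) // muln1 add0n => h.
  by rewrite -(@dvdn_addl (3 * logn 2 (\prod_(p in Q) (p : nat)))) ?dvdn_mulr // -h dvdn_mulr.
have [i Qi] := dvdnP Q3.
exists i; split=> //.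
  rewrite -(cardsID X S) SE (card_in_imset injE) EQ cardsX cardsT card_ord Qi.
  by congr (_ + _); clear; lia.
pose w := 6 ^ i * \prod_(p in Q) (p : nat).
have w0 : 0 < w by rewrite muln_gt0 expn_gt0 Q0.
have xw : x ^ 3 = \prod_(a in S :&: X) (a : nat) * w ^ 3.
  by rewrite prodS Qi /w expnMn -expnM.
have /dvdnP[y xy] : w %| x by rewrite -(@dvdn_pexp2r _ _ 3) // xw dvdn_mull.
exists y; apply/eqP; rewrite -(@eqn_pmul2r (w ^ 3)) ?expn_gt0 ?w0 //.
by rewrite -xw xy expnMn.
Qed.

(** For a cube subset [S] of size [k], [#|S :&: X|] is [k] if [9 %| k] and congruent to [k] modulo
    [9] otherwise. It is never [0], so [X] would contain a forbidden subset. *)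
Lemma large_set_without_cube_subset k R : 0 < k -> R = (if 9 %| k then 2 else 3) ->
  exists C, forall n e, 11 <= e -> 2 ^ (32 * e) <= n ->
  exists A : {set 'I_n.+1}, [/\ ord0 \notin A, ~ has_cube_subset k A &
    \sum_(t < R) prime_count (n %/ t.+1) + 2 ^ (20 * e) <= #|A| + C + R * 2 ^ (16 * e)].
Proof.
move=> k0 Rk; have [C HC] := large_cube_free_subset k; exists C => n e e11 en.
have [P1 [P2 [PP c1 c2 P3]]] := prime_pair_exists e11 en.
have [X [XU Xfree XC]] := HC n e P1 P2 PP c1 c2.
set M := 2 ^ (16 * e) in P3 *.
have M3 : 3 <= M.
  by apply: (@leq_trans (2 ^ 2)); rewrite // leq_exp2l //; move: e11; clear; lia.
have R23 : 2 <= R <= 3 by rewrite Rk; case: ifP.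
have RM : R <= M by move: R23 M3; clear; lia.
have XP b : b \in X -> [/\ 0 < b, ~~ (2 %| b) & forall p, prime p -> M < p -> ~~ (p %| b)].
  move=> /(subsetP XU)/(prime_productsP PP)[p [q [pP qP pq bE lb]]].
  have [Pp _ _] := PP.
  have pU : p \in P1 :|: P2 by rewrite inE pP.
  have qU : q \in P1 :|: P2 by rewrite inE qP orbT.
  have [/andP[p3 pM] /andP[q3 qM]] := (P3 p pU, P3 q qU).
  have b0 : 0 < b by rewrite bE muln_gt0 !prime_gt0 ?Pp.
  have nd r : prime r -> r != p -> r != q -> ~~ (r %| b).
    move=> rp /negbTE rep /negbTE req; have := lb r rp; rewrite rep req => /eqP.
    by rewrite -leqn0 leqNgt logn_gt0 mem_primes rp b0.
  split=> //.
    by apply: nd => //; apply/eqP => e2; [move: p3|move: q3]; rewrite -e2.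
  by move=> r rp Mr; apply: nd => //; apply/eqP => e2; [move: pM|move: qM]; rewrite -e2 leqNgt Mr.
set B := @prime_multiple n R @: prime_multiple_index n R M.
exists (X :|: B); split.
- rewrite inE negb_or; apply/andP; split.
    by apply/negP => /XP[].
  apply/negP => /imsetP[z]; rewrite inE => /and3P[zp _ zn] /(congr1 val) /=.
  rewrite inordK ?ltnS // => /esym/eqP; rewrite muln_eq0 /= => /eqP z0.
  by move: zp; rewrite z0.
- move=> [S [SA Sk [x Sx]]].
  have [i [Si Ri [y Sy]]] := cube_subset_restrict M3 R23 XP SA Sx.
  have S0 : 0 < #|S :&: X|.
    move: Si Ri; rewrite Sk Rk; case: ifP => k9.
      by move=> kE /(_ erefl) i0; move: kE k0; rewrite i0 muln0 addn0 => <-.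
    by move=> kE _; rewrite lt0n; apply: contraFneq k9 => z; rewrite kE z dvdn_mulr.
  apply: (Xfree (S :&: X)); first exact: subsetIr.
    by rewrite S0 -Sk subset_leq_card // subsetIl.
  by exists y.
have dXB : [disjoint X & B].
  apply/pred0P => a /=; apply/negP => /andP[aX /imsetP[z]].
  rewrite inE => /and3P[zp zM zn] az; have [_ _ /(_ _ zp zM)] := XP _ aX.
  by rewrite az inordK ?ltnS // dvdn_mull.
rewrite cardsU disjoint_setI0 // cards0 subn0.
apply: leq_trans (leq_add (card_prime_multiples n RM) XC) _.
by rewrite -/B (addnC #|X| #|B|) -!addnA leq_add2l addnCA [R * M + C]addnC.
Qed.

Local Open Scope ring_scope.

(** * Passage to [maxfree] *)

(** The increasing tuple is the ordered enumeration of the subset; an integer root is replaced by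
    its absolute value. *)
Lemma has_cube_subset_power_solution k n (A : {set 'I_n.+1}) :
  has_cube_subset k A <-> has_power_solution k 3 A.
Proof.
split=> [[S [SA Sk [x Sx]]]|[a [x [a_lt aA ax]]]].
  pose a (i : 'I_k) := nth ord0 (enum S) i.
  have sS : size (enum S) = k by rewrite -cardE.
  have aS i : a i \in S by rewrite -mem_enum mem_nth ?sS.
  exists a, x%:Z; split.
  - move=> i j ij; have ss : sorted ltn (map val (enum S)).
      rewrite /enum_mem -enumT sorted_map sorted_filter //.
        by move=> ? ? ?; exact: ltn_trans.
      by rewrite -sorted_map val_enum_ord iota_ltn_sorted.
    have := sorted_ltn_nth ltn_trans 0%N ss.
    move=> /(_ i j); rewrite !inE size_map sS !ltn_ord => /(_ isT isT ij).
    by rewrite !(nth_map ord0) ?sS.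
  - by move=> i; apply: (subsetP SA).
  rewrite -(big_morph Posz PoszM erefl) (_ : x%:Z ^+ 3 = (x ^ 3)%N); last first.
    by rewrite !exprS expr0 !expnS expn0 !PoszM.
  by congr Posz; rewrite -Sx -[RHS]big_enum [RHS](big_nth ord0) sS big_mkord.
have a_inj : injective a.
  by move=> i j aij; apply: val_inj; case: (ltngtP i j) => // /a_lt; rewrite aij ltnn.
exists [set a i | i : 'I_k]; split.
- by apply/subsetP => _ /imsetP[i _ ->].
- by rewrite card_imset // card_ord.
exists `|x|%N; rewrite big_imset /=; last by move=> i j _ _; exact: a_inj.
rewrite -abszX -ax -(big_morph Posz PoszM erefl) /=.
by apply: eq_bigl => i; rewrite inE.
Qed.

Lemma maxfree_le k n c :
  (forall A : {set 'I_n.+1}, ord0 \notin A -> (c < #|A|)%N -> has_cube_subset k A) ->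
  (maxfree k 3 n <= c)%N.
Proof.
move=> H; apply/bigmax_leqP => A /andP[A0 /asboolP nA].
rewrite leqNgt; apply/negP => cA; apply: nA.
by apply/has_cube_subset_power_solution; exact: H.
Qed.

Lemma le_maxfree k n (A : {set 'I_n.+1}) :
  ord0 \notin A -> ~ has_cube_subset k A -> (#|A| <= maxfree k 3 n)%N.
Proof.
move=> A0 nA; rewrite /maxfree; apply: (@leq_bigmax_cond _ _ (fun A : {set _} => #|A|)).
by rewrite A0 /=; apply/asboolP => /has_cube_subset_power_solution.
Qed.

Lemma primepi_div (R : realType) (n d : nat) : (0 < d)%N ->
  primepi (n%:R / d%:R : R) = prime_count (n %/ d).
Proof.
move=> d0; have dR : 0 < d%:R :> R by rewrite ltr0n.
suff -> : (n %/ d)%N = Num.truncn (n%:R / d%:R : R) by [].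
apply/esym/truncn_def; rewrite ler_pdivlMr // ltr_pdivrMr // -!natrM ler_nat ltr_nat.
by rewrite leq_trunc_div ltn_ceil.
Qed.

Lemma Pi2E (R : realType) n :
  Pi2 R n = (\sum_(t < 2) prime_count (n %/ t.+1))%N%:R.
Proof.
rewrite /Pi2 !big_ord_recl big_ord0 addn0 natrD.
by rewrite -(primepi_div R n (isT : (0 < 1)%N)) divr1 -(primepi_div R n (isT : (0 < 2)%N)).
Qed.

Lemma Pi3E (R : realType) n :
  Pi3 R n = (\sum_(t < 3) prime_count (n %/ t.+1))%N%:R.
Proof.
by rewrite /Pi3 Pi2E (primepi_div R n (isT : (0 < 3)%N)) -natrD [in RHS]big_ord_recr.
Qed.

Lemma powR_expn2 (R : realType) (a b : nat) (r : R) : a%:R * r = b%:R ->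
  ((2 ^ a)%N%:R : R) `^ r = (2 ^ b)%N%:R.
Proof. by move=> ab; rewrite !natrX -!powR_mulrn // -powRrM ab. Qed.

Lemma maxfree_upper_bound (R : realType) (k r : nat) :
  (3 %| k)%N -> (35 < k)%N -> r = (if 9 %| k then 2 else 3)%N ->
  (fun n => (maxfree k 3 n)%:R - (\sum_(t < r) prime_count (n %/ t.+1))%N%:R : R)
    \ll (fun n => n%:R `^ (5 / 6)).
Proof.
move=> k3 k35 rE; have [C HC] := cube_subset_of_card k3 k35 rE.
(* The factor [2 ^ 5] bridges [2 ^ (5 * f)] and [2 ^ (5 * f.+1)]; adding [1] keeps the constant
   positive. *)
exists (C * 2 ^ 5 + 1)%N%:R; first by rewrite addn1 ltr0n.
near=> n.
have n0 : (0 < n)%N by near: n; exact: nbhs_infty_gt.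
set f := (trunc_log 2 n %/ 6)%N.
have lo : (2 ^ (6 * f) <= n)%N.
  apply: leq_trans (trunc_logP (isT : 1 < 2)%N n0).
  by rewrite leq_exp2l // mulnC leq_trunc_div.
have hi : (n < 2 ^ (6 * f.+1))%N.
  apply: leq_trans (trunc_log_ltn n (isT : 1 < 2)%N) _.
  by rewrite leq_exp2l // mulnC ltn_ceil.
have fl : (2 ^ (5 * f))%N%:R <= (n%:R : R) `^ (5 / 6).
  rewrite -(@powR_expn2 R (6 * f) (5 * f) (5 / 6)); last by rewrite !natrM; field.
  by apply: ge0_ler_powR; rewrite ?nnegrE ?ler0n ?ler_nat // divr_ge0.
have mf : (maxfree k 3 n <= \sum_(t < r) prime_count (n %/ t.+1) + C * 2 ^ (5 * f.+1))%N.
  by apply: maxfree_le => A A0 lt; apply: (HC n f.+1).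
rewrite lerBlDl; apply: le_trans (_ : (\sum_(t < r) prime_count (n %/ t.+1)
   + C * 2 ^ (5 * f.+1))%N%:R <= _); first by rewrite ler_nat.
rewrite natrD lerD2l mulnS expnD mulnA natrM.
by apply: ler_pM => //; rewrite ler_nat addn1.
Unshelve. all: by end_near.
Qed.

(** The construction gains order [n ^ (20/32)], which leaves room above [n ^ (9/16)]. The
    logarithmic factor is at least [1] once [n >= expR 1] and is dropped. *)
Lemma maxfree_lower_bound (R : realType) (k r : nat) (a b : R) : (0 < k)%N ->
  r = (if 9 %| k then 2 else 3)%N -> a <= 9 / 16 -> 0 <= b ->
  (fun n => n%:R `^ a / ln n%:R `^ b) \ll
  (fun n => (maxfree k 3 n)%:R - (\sum_(t < r) prime_count (n %/ t.+1))%N%:R : R).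
Proof.
move=> k0 rE a916 b0; have [C HC] := large_set_without_cube_subset k0 rE.
(* The factor between [2 ^ (18 * e)] and [2 ^ (18 * e.+1)], where [18 / 32 = 9 / 16]. *)
exists (2 ^ 18); first by rewrite exprn_gt0.
near=> n.
have n0 : (0 < n)%N by near: n; exact: nbhs_infty_gt.
have ne : expR 1 <= n%:R :> R by near: n; exact: nbhs_infty_ger.
have nC : (2 ^ (32 * (C + 11)) <= n)%N by near: n; exact: nbhs_infty_ge.
set e := (trunc_log 2 n %/ 32)%N.
have lo : (2 ^ (32 * e) <= n)%N.
  apply: leq_trans (trunc_logP (isT : 1 < 2)%N n0).
  by rewrite leq_exp2l // mulnC leq_trunc_div.
have hi : (n < 2 ^ (32 * e.+1))%N.
  apply: leq_trans (trunc_log_ltn n (isT : 1 < 2)%N) _.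
  by rewrite leq_exp2l // mulnC ltn_ceil.
have eC : (C + 11 <= e)%N.
  have := leq_ltn_trans nC hi; rewrite ltn_exp2l //; clear; lia.
have e11 : (11 <= e)%N by apply: leq_trans eC; rewrite leq_addl.
have [A [A0 nA cA]] := HC n e e11 lo.
have AF := le_maxfree A0 nA.
(* Passing from [20 * e] to [18 * e] frees a factor of at least [C + 11], which absorbs [C] and
   [r * 2 ^ (16 * e)]. *)
have gain : (\sum_(t < r) prime_count (n %/ t.+1) + 2 ^ (18 * e) <= maxfree k 3 n)%N.
  have E2 : (2 ^ (18 * e) * (C + 11) <= 2 ^ (20 * e))%N.
    rewrite (_ : 20 * e = 18 * e + 2 * e)%N ?expnD ?leq_mul2l; last by clear; lia.
    apply/orP; right; apply: leq_trans eC _; apply: leq_trans (ltnW (ltn_expl e (isT : 1 < 2)%N)) _.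
    by rewrite leq_pmulr // muln_gt0 !expn_gt0.
  have E16 : (2 ^ (16 * e) <= 2 ^ (18 * e))%N by rewrite leq_exp2l //; clear; lia.
  have r3 : (r <= 3)%N by rewrite rE; case: ifP.
  have rE16 := leq_mul r3 E16.
  have E0 : (0 < 2 ^ (18 * e))%N by rewrite expn_gt0.
  have CE := leq_mul (leqnn C) E0.
  move: E2 rE16 CE cA AF; move: (\sum_(t < r) _)%N (#|A|) (maxfree k 3 n) => P B m.
  move: (2 ^ (18 * e))%N (2 ^ (20 * e))%N (r * 2 ^ (16 * e))%N => X Y Z; clear; nia.
have n1 : 1 <= n%:R :> R by rewrite ler1n.
have nub : (n%:R : R) `^ (9 / 16) <= (2 ^ (18 * e.+1))%N%:R.
  rewrite -(@powR_expn2 R (32 * e.+1) (18 * e.+1) (9 / 16)); last by rewrite !natrM; field.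
  by apply: ge0_ler_powR; rewrite ?nnegrE ?ler0n ?ler_nat ?(ltnW hi) // divr_ge0.
have ln1 : 1 <= ln (n%:R : R) by rewrite -ler_expR lnK // posrE ltr0n.
have lnb : 1 <= ln (n%:R : R) `^ b by have := ler_powR ln1 b0; rewrite powRr0.
apply: (@le_trans _ _ ((n%:R : R) `^ a)).
  by rewrite ler_pdivrMr ?(lt_le_trans ltr01) // ler_peMr // powR_ge0.
apply: le_trans (ler_powR n1 a916) _; apply: le_trans nub _.
rewrite mulnS expnD natrM natrX ler_pM2l ?exprn_gt0 // lerBrDl -natrD ler_nat.
exact: gain.
Unshelve. all: by end_near.
Qed.

(** * The twelve residue classes modulo [36] *)

Theorem theorem14 (R : realType) (l : nat) (hl : (1 <= l)%N) :
  ((fun n => n%:R `^ ((9 * l%:R) / (18 * l%:R - 2))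
             / ln n%:R `^ ((9 * l%:R) / (9 * l%:R - 1)))
     \ll (fun n => (maxfree (36 * l) 3 n)%:R - Pi2 R n)
   /\ (fun n => (maxfree (36 * l) 3 n)%:R - Pi2 R n)
     \ll (fun n => n%:R `^ (5 / 6))) /\
  ((fun n => n%:R `^ ((9 * l%:R) / (18 * l%:R - 2))
             / ln n%:R `^ ((9 * l%:R) / (9 * l%:R - 1)))
     \ll (fun n => (maxfree (36 * l + 3) 3 n)%:R - Pi3 R n)
   /\ (fun n => (maxfree (36 * l + 3) 3 n)%:R - Pi3 R n)
     \ll (fun n => n%:R `^ (5 / 6))) /\
  ((fun n => n%:R `^ ((9 * l%:R + 1) / (18 * l%:R))
             / ln n%:R `^ ((9 * l%:R + 1) / (9 * l%:R)))
     \ll (fun n => (maxfree (36 * l + 6) 3 n)%:R - Pi3 R n)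
   /\ (fun n => (maxfree (36 * l + 6) 3 n)%:R - Pi3 R n)
     \ll (fun n => n%:R `^ (5 / 6))) /\
  ((fun n => n%:R `^ ((9 * l%:R + 1) / (18 * l%:R))
             / ln n%:R `^ ((9 * l%:R + 1) / (9 * l%:R)))
     \ll (fun n => (maxfree (36 * l + 9) 3 n)%:R - Pi2 R n)
   /\ (fun n => (maxfree (36 * l + 9) 3 n)%:R - Pi2 R n)
     \ll (fun n => n%:R `^ (5 / 6))) /\
  ((fun n => n%:R `^ ((9 * l%:R + 3) / (18 * l%:R + 4))
             / ln n%:R `^ ((9 * l%:R + 3) / (9 * l%:R + 2)))
     \ll (fun n => (maxfree (36 * l + 12) 3 n)%:R - Pi3 R n)
   /\ (fun n => (maxfree (36 * l + 12) 3 n)%:R - Pi3 R n)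
     \ll (fun n => n%:R `^ (5 / 6))) /\
  ((fun n => n%:R `^ ((9 * l%:R + 3) / (18 * l%:R + 4))
             / ln n%:R `^ ((9 * l%:R + 3) / (9 * l%:R + 2)))
     \ll (fun n => (maxfree (36 * l + 15) 3 n)%:R - Pi3 R n)
   /\ (fun n => (maxfree (36 * l + 15) 3 n)%:R - Pi3 R n)
     \ll (fun n => n%:R `^ (5 / 6))) /\
  ((fun n => n%:R `^ ((9 * l%:R + 4) / (18 * l%:R + 6))
             / ln n%:R `^ ((9 * l%:R + 4) / (9 * l%:R + 3)))
     \ll (fun n => (maxfree (36 * l + 18) 3 n)%:R - Pi2 R n)
   /\ (fun n => (maxfree (36 * l + 18) 3 n)%:R - Pi2 R n)
     \ll (fun n => n%:R `^ (5 / 6))) /\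
  ((fun n => n%:R `^ ((9 * l%:R + 4) / (18 * l%:R + 6))
             / ln n%:R `^ ((9 * l%:R + 4) / (9 * l%:R + 3)))
     \ll (fun n => (maxfree (36 * l + 21) 3 n)%:R - Pi3 R n)
   /\ (fun n => (maxfree (36 * l + 21) 3 n)%:R - Pi3 R n)
     \ll (fun n => n%:R `^ (5 / 6))) /\
  ((fun n => n%:R `^ ((9 * l%:R + 6) / (18 * l%:R + 10))
             / ln n%:R `^ ((9 * l%:R + 6) / (9 * l%:R + 5)))
     \ll (fun n => (maxfree (36 * l + 24) 3 n)%:R - Pi3 R n)
   /\ (fun n => (maxfree (36 * l + 24) 3 n)%:R - Pi3 R n)
     \ll (fun n => n%:R `^ (5 / 6))) /\
  ((fun n => n%:R `^ ((9 * l%:R + 6) / (18 * l%:R + 10))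
             / ln n%:R `^ ((9 * l%:R + 6) / (9 * l%:R + 5)))
     \ll (fun n => (maxfree (36 * l + 27) 3 n)%:R - Pi2 R n)
   /\ (fun n => (maxfree (36 * l + 27) 3 n)%:R - Pi2 R n)
     \ll (fun n => n%:R `^ (5 / 6))) /\
  ((fun n => n%:R `^ ((9 * l%:R + 7) / (18 * l%:R + 12))
             / ln n%:R `^ ((9 * l%:R + 7) / (9 * l%:R + 6)))
     \ll (fun n => (maxfree (36 * l + 30) 3 n)%:R - Pi3 R n)
   /\ (fun n => (maxfree (36 * l + 30) 3 n)%:R - Pi3 R n)
     \ll (fun n => n%:R `^ (5 / 6))) /\
  ((fun n => n%:R `^ ((9 * l%:R + 7) / (18 * l%:R + 12))
             / ln n%:R `^ ((9 * l%:R + 7) / (9 * l%:R + 6)))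
     \ll (fun n => (maxfree (36 * l + 33) 3 n)%:R - Pi3 R n)
   /\ (fun n => (maxfree (36 * l + 33) 3 n)%:R - Pi3 R n)
     \ll (fun n => n%:R `^ (5 / 6))).
Proof.
have l1 : (1 : R) <= l%:R by rewrite ler1n.
(* For [l >= 1] every lower exponent is at most [9 / 16], with equality for [9l / (18l - 2)] at
   [l = 1]. Hence only the divisibility of [k] by [9] matters, which decides between [Pi2] and
   [Pi3]. *)
have two (k : nat) (a b : R) : (3 %| k)%N -> (35 < k)%N -> (9 %| k)%N ->
    a <= 9 / 16 -> 0 <= b ->
    ((fun n => n%:R `^ a / ln n%:R `^ b) \ll (fun n => (maxfree k 3 n)%:R - Pi2 R n)
     /\ (fun n => (maxfree k 3 n)%:R - Pi2 R n) \ll (fun n => n%:R `^ (5 / 6))).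
  move=> k3 k35 k9 a916 b0; rewrite (funext (Pi2E R)).
  split; last by apply: maxfree_upper_bound; rewrite // k9.
  by apply: maxfree_lower_bound; rewrite ?k9 //; apply: leq_ltn_trans k35.
have three (k : nat) (a b : R) : (3 %| k)%N -> (35 < k)%N -> ~~ (9 %| k)%N ->
    a <= 9 / 16 -> 0 <= b ->
    ((fun n => n%:R `^ a / ln n%:R `^ b) \ll (fun n => (maxfree k 3 n)%:R - Pi3 R n)
     /\ (fun n => (maxfree k 3 n)%:R - Pi3 R n) \ll (fun n => n%:R `^ (5 / 6))).
  move=> k3 k35 /negbTE k9 a916 b0; rewrite (funext (Pi3E R)).
  split; last by apply: maxfree_upper_bound; rewrite // k9.
  by apply: maxfree_lower_bound; rewrite ?k9 //; apply: leq_ltn_trans k35.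
repeat match goal with |- (_ /\ _) /\ _ => split end.
all: first [apply: two | apply: three].
all: try by move: hl; clear; lia.
all: try by rewrite ler_pdivrMr; lra.
all: by apply: divr_ge0; lra.
Qed.
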